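(* Let $G$ be a finite group and let $H$ be a Schur cover of $G$ with $H/M=G$. If $\alpha$ is an AI-automorphism of $H$, then $\tilde K(G,3)\cong\tau^\flat(H)/\operatorname{im}\iota$ for the monomorphism $\iota\colon M^2\to\tau^\flat(H)$ given by $$(m_1,m_2)\mapsto m_1m_2^\ast\prod_{i=1}^{\ell}\big[\alpha^{-1}(k_i),(\alpha^{-1}(h_i))^\ast\big]_{\tau^\flat(H)},$$ where the elements $h_i,k_i\in H$ are defined by $\alpha(m_1m_2)=m_2^{-1}m_1^{-1}[h_\ell,k_\ell]\cdots[h_1,k_1]$.
   Context: Conventions: $[g,h]=g^{-1}h^{-1}gh$, $g^h=h^{-1}gh$, and $X'$ is the commutator subgroup of a group $X$. For a group $X$ let $X^\ast$ be an isomorphic copy via $g\mapsto g^\ast$, and let $X\star X^\ast$ be the free product. The group $\nu(X)$ is the quotient of $X\star X^\ast$ by the normal closure of all elements $[x,y^\ast]^z[x^z,(y^z)^\ast]^{-1}$ and $[x,y^\ast]^{(z^\ast)}[x^z,(y^z)^\ast]^{-1}$ with $x,y,z\in X$. Put $\nabla(X)=\langle [x,x^\ast]: x\in X\rangle\leq \nu(X)$ and $\tau(X)=\nu(X)/\nabla(X)$. Put $M^\flat(X)=\langle [x,y^\ast]: x,y\in X,\ [x,y]=1\rangle\leq \tau(X)$ and $\tau^\flat(X)=\tau(X)/M^\flat(X)$. Elements of $X$ and $X^\ast$ are identified with their images in these quotients; $[\cdot,\cdot]_{\tau^\flat(H)}$ means the commutator taken in $\tau^\flat(H)$. $K(X,n)=\{(g_1,\ldots,g_n)\in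 X^n: g_1\cdots g_n\in X'\}$. For a free presentation $G=F/N$ with $F$ free of finite rank, $\tilde K(G,n)=K(F,n)/K(N,n)^{F^n}$, where $K(N,n)^{F^n}$ is the normal closure of $K(N,n)$ in $F^n$; up to isomorphism this does not depend on the presentation. A Schur cover of $G$ is a group $H$ such that $H/M\cong G$ for some $M\leq H'\cap Z(H)$ isomorphic to the Schur multiplier $M(G)=H^2(G,\mathbb{C}^\times)\cong H_2(G,\mathbb{Z})$; ''$H/M=G$'' refers to such an $M$. An AI-automorphism of a group is an automorphism that induces the inversion automorphism on its abelianisation. *)

(* Defs.v *)
From HB Require Import structures.
From mathcomp Require Import all_boot all_order all_algebra.
From mathcomp Require Import fingroup.
From mathcomp Require Import generic_quotient.
From mathcomp Require Import all_classical reals.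
From mathcomp Require Import complex.

Set Implicit Arguments.
Unset Strict Implicit.
Unset Printing Implicit Defensive.

Import Algebra.

Local Open Scope group_scope.
Local Open Scope classical_set_scope.
Local Open Scope quotient_scope.

(* Groups are MathComp's (possibly infinite) groupTypes, in which
   x ^ y = y^-1 * (x * y) and [~ x, y] = x^-1 * (y^-1 * (x * y)).  Subgroups
   are the groupClosed predicates. *)

Notation ghom G H := (UMagmaMorphism.type G H).

Definition isomorphic (G H : groupType) : Prop :=
  exists f : ghom G H, bijective f.

Lemma morph_hom (G H : groupType) (f : G -> H) :
  {morph f : x y / x * y} -> monoid_morphism f.
Proof. by move=> fM; split=> //; apply: (mulgI (f 1)); rewrite -fM !mulg1. Qed.

Section Subgroups.
Variable G : groupType.
Implicit Types (S : set G) (x y : G).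

Definition conj_stable S : Prop := forall x y, S x -> S (x ^ y).

Definition gen S : {pred G} :=
  [pred x | `[< forall K : groupClosed G, S `<=` [set` K] -> x \in K >]].

Definition normal_closure S : {pred G} :=
  [pred x | `[< forall K : groupClosed G,
                  conj_stable [set` K] -> S `<=` [set` K] -> x \in K >]].

Lemma genP S x :
  reflect (forall K : groupClosed G, S `<=` [set` K] -> x \in K) (x \in gen S).
Proof. exact: asboolP. Qed.

Lemma normal_closureP S x :
  reflect (forall K : groupClosed G,
             conj_stable [set` K] -> S `<=` [set` K] -> x \in K)
          (x \in normal_closure S).
Proof. exact: asboolP. Qed.

Lemma gen_sub S x : S x -> x \in gen S.
Proof. by move=> Sx; apply/genP => K; apply. Qed.

Lemma normal_closure_sub S x : S x -> x \in normal_closure S.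
Proof. by move=> Sx; apply/normal_closureP => K _; apply. Qed.

Lemma gen_mul S : mulg_closed (gen S).
Proof.
by move=> x y /genP Sx /genP Sy; apply/genP => K SK; rewrite gpredM ?Sx ?Sy.
Qed.
Lemma gen_one S : 1 \in gen S.
Proof. by apply/genP => K _; exact: gpred1. Qed.
Lemma gen_inv S : invg_closed (gen S).
Proof. by move=> x /genP Sx; apply/genP => K SK; rewrite gpredV Sx. Qed.

HB.instance Definition _ S := isMulClosed.Build G (gen S) (@gen_mul S).
HB.instance Definition _ S := isMul1Closed.Build G (gen S) (@gen_one S).
HB.instance Definition _ S := isInvClosed.Build G (gen S) (@gen_inv S).

Lemma normal_closure_mul S : mulg_closed (normal_closure S).
Proof.
move=> x y /normal_closureP Sx /normal_closureP Sy.
by apply/normal_closureP => K nK SK; rewrite gpredM ?Sx ?Sy.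
Qed.
Lemma normal_closure_one S : 1 \in normal_closure S.
Proof. by apply/normal_closureP => K _ _; exact: gpred1. Qed.
Lemma normal_closure_inv S : invg_closed (normal_closure S).
Proof.
move=> x /normal_closureP Sx.
by apply/normal_closureP => K nK SK; rewrite gpredV Sx.
Qed.

HB.instance Definition _ S :=
  isMulClosed.Build G (normal_closure S) (@normal_closure_mul S).
HB.instance Definition _ S :=
  isMul1Closed.Build G (normal_closure S) (@normal_closure_one S).
HB.instance Definition _ S :=
  isInvClosed.Build G (normal_closure S) (@normal_closure_inv S).

Lemma normal_closureJ S : conj_stable [set` normal_closure S].
Proof.
move=> x y /= /normal_closureP Sx; apply/normal_closureP => K nK SK.
exact/nK/Sx.
Qed.

Lemma normal_closure_id (K : groupClosed G) :
  conj_stable [set` K] -> normal_closure [set` K] =i K.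
Proof.
move=> nK x; apply/idP/idP => [/normal_closureP -> //|].
exact: normal_closure_sub.
Qed.

Lemma gen_conj S y : (forall x, S x -> x ^ y \in gen S) ->
  forall x, x \in gen S -> x ^ y \in gen S.
Proof.
move=> Sy x /genP xS; pose K : {pred G} := fun z => z ^ y \in gen S.
have KM : mulg_closed K.
  move=> u v uK vK; change ((u * v) ^ y \in gen S).
  by rewrite conjMg; exact: gpredM.
have K1 : 1 \in K by change (1 ^ y \in gen S); rewrite conj1g; exact: gpred1.
have KV : invg_closed K.
  move=> u uK; change (u^-1 ^ y \in gen S).
  by rewrite conjVg; exact: gpredVr.
pose kM := isMulClosed.Build G K KM.
pose k1 := isMul1Closed.Build G K K1.
pose kV := isInvClosed.Build G K KV.
pose k : groupClosed G := HB.pack K kM k1 kV.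
exact: (xS k Sy).
Qed.

Definition center : {pred G} := [pred x | `[< forall y, commute x y >]].

(* The commutator subgroup X' of a subgroup X of the ambient group G. *)
Definition derived (X : {pred G}) : {pred G} :=
  gen [set z | exists x y, [/\ x \in X, y \in X & z = [~ x, y]]].

HB.instance Definition _ (X : {pred G}) := GroupClosed.on (derived X).

Definition full : {pred G} := [pred x | true].

Lemma full_mul : mulg_closed full. Proof. by []. Qed.
Lemma full_one : 1 \in full. Proof. by []. Qed.
Lemma full_inv : invg_closed full. Proof. by []. Qed.
HB.instance Definition _ := isMulClosed.Build G full full_mul.
HB.instance Definition _ := isMul1Closed.Build G full full_one.
HB.instance Definition _ := isInvClosed.Build G full full_inv.

End Subgroups.

Arguments center : clear implicits.
Arguments full : clear implicits.

Section SubgroupType.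
Variables (G : groupType) (K : groupClosed G).

Definition subgroup_type : Type := {x : G | x \in K}.

HB.instance Definition _ := SubChoice.on subgroup_type.

Lemma subg_closed : group_closed K.
Proof. by split=> [|x y xK yK]; [exact: gpred1 | exact: gpredF]. Qed.

HB.instance Definition _ :=
  SubChoice_isSubGroup.Build G (fun x => x \in K) subgroup_type subg_closed.

End SubgroupType.

(* quot S is the quotient of G by the normal closure of S, hence the usual
   quotient G / S when S is a normal subgroup of G. *)
Section Quotient.
Variables (G : groupType) (S : set G).

Definition quot_rel : rel G := fun x y => x^-1 * y \in normal_closure S.

Lemma quot_rel_refl : reflexive quot_rel.
Proof. by move=> x; rewrite /quot_rel mulVg gpred1. Qed.

Lemma quot_rel_sym : symmetric quot_rel.
Proof. by move=> x y; rewrite /quot_rel -gpredV invgM invgK. Qed.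

Lemma quot_rel_trans : transitive quot_rel.
Proof.
move=> y x z xy yz; rewrite /quot_rel.
by rewrite -(mulKVg y z) mulgA gpredM.
Qed.

Canonical quot_equiv :=
  EquivRel quot_rel quot_rel_refl quot_rel_sym quot_rel_trans.

Definition quot : Type := {eq_quot quot_rel}.

HB.instance Definition _ := Choice.on quot.
HB.instance Definition _ := EqQuotient.on quot.

Definition quot_mul (a b : quot) : quot := \pi_quot (repr a * repr b).
Definition quot_one : quot := \pi_quot 1.
Definition quot_inv (a : quot) : quot := \pi_quot (repr a)^-1.

Lemma quot_eqP x y :
  reflect (\pi_quot x = \pi_quot y) (x^-1 * y \in normal_closure S).
Proof. exact: (@eqmodP _ quot_equiv). Qed.

Lemma quot_reprP x : (repr (\pi_quot x))^-1 * x \in normal_closure S.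
Proof. by apply/quot_eqP; rewrite reprK. Qed.

Lemma quot_piM x y : quot_mul (\pi_quot x) (\pi_quot y) = \pi_quot (x * y).
Proof.
apply/quot_eqP; rewrite invgM.
have -> : (repr (\pi_quot y))^-1 * (repr (\pi_quot x))^-1 * (x * y) =
  (repr (\pi_quot y))^-1 * y * ((repr (\pi_quot x))^-1 * x) ^ y.
  by rewrite /conjg !mulgA mulgK.
by rewrite gpredM ?quot_reprP// normal_closureJ//= quot_reprP.
Qed.

Lemma quot_piV x : quot_inv (\pi_quot x) = \pi_quot x^-1.
Proof.
apply/quot_eqP; rewrite invgK -gpredV invgM invgK.
have -> : x * (repr (\pi_quot x))^-1 =
  ((repr (\pi_quot x))^-1 * x) ^ (repr (\pi_quot x))^-1.
  by rewrite /conjg invgK !mulgA mulgV mul1g.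
by rewrite normal_closureJ//= quot_reprP.
Qed.

Lemma quot_pi_surj a : exists x, \pi_quot x = a.
Proof. by exists (repr a); rewrite reprK. Qed.

Lemma quot_mulA : associative quot_mul.
Proof.
move=> a b c; case: (quot_pi_surj a) (quot_pi_surj b) (quot_pi_surj c).
move=> x <- [y <-] [z <-].
by rewrite !quot_piM mulgA.
Qed.
Lemma quot_mul1 : left_id quot_one quot_mul.
Proof. by move=> a; case: (quot_pi_surj a) => x <-; rewrite quot_piM mul1g. Qed.
Lemma quot_mulr1 : right_id quot_one quot_mul.
Proof. by move=> a; case: (quot_pi_surj a) => x <-; rewrite quot_piM mulg1. Qed.
Lemma quot_mulV : left_inverse quot_one quot_inv quot_mul.
Proof.
by move=> a; case: (quot_pi_surj a) => x <-; rewrite quot_piV quot_piM mulVg.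
Qed.
Lemma quot_mulVr : right_inverse quot_one quot_inv quot_mul.
Proof.
by move=> a; case: (quot_pi_surj a) => x <-; rewrite quot_piV quot_piM mulgV.
Qed.

HB.instance Definition _ := isGroup.Build quot
  quot_mulA quot_mul1 quot_mulr1 quot_mulV quot_mulVr.

Definition qmap (x : G) : quot := \pi_quot x.

Lemma qmapM : {morph qmap : x y / x * y}.
Proof. by move=> x y; rewrite /qmap -quot_piM. Qed.
HB.instance Definition _ :=
  isUMagmaMorphism.Build G quot qmap (morph_hom qmapM).

Lemma qmap_ker x : (qmap x == 1) = (x \in normal_closure S).
Proof.
apply/eqP/idP => [/esym/quot_eqP|xS]; first by rewrite invg1 mul1g.
by apply/esym/quot_eqP; rewrite invg1 mul1g.
Qed.

Lemma qmap_eq x y : x / y \in normal_closure S -> qmap x = qmap y.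
Proof. by rewrite -qmap_ker gmulfF => /eqP /divg1_eq. Qed.

Lemma qmap_surj a : exists x, qmap x = a.
Proof. exact: quot_pi_surj. Qed.

End Quotient.

Section Kernel.
Variables (G H : groupType) (f : ghom G H).

Definition ker : {pred G} := [pred x | f x == 1].

Lemma ker_mul : mulg_closed ker.
Proof. by move=> x y; rewrite !inE gmulfM => /eqP-> /eqP->; rewrite mulg1. Qed.
Lemma ker_one : 1 \in ker. Proof. by rewrite inE gmulf1. Qed.
Lemma ker_inv : invg_closed ker.
Proof. by move=> x; rewrite !inE gmulfV => /eqP->; rewrite invg1. Qed.
HB.instance Definition _ := isMulClosed.Build G ker ker_mul.
HB.instance Definition _ := isMul1Closed.Build G ker ker_one.
HB.instance Definition _ := isInvClosed.Build G ker ker_inv.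

Lemma ker_normal : conj_stable [set` ker].
Proof.
by move=> x y /=; rewrite !inE gmulfJ => /eqP->; rewrite conj1g.
Qed.

End Kernel.

Lemma quot_lift (G T : groupType) (S : set G) (f : ghom G T) :
  S `<=` [set` ker f] ->
  exists g : ghom (quot S) T, forall x, g (qmap S x) = f x.
Proof.
move=> Sf; pose g0 (a : quot S) := f (repr a).
have g0E x : g0 (qmap S x) = f x.
  have /normal_closureP/(_ (ker f) (@ker_normal _ _ f) Sf) := quot_reprP S x.
  by rewrite inE gmulfM gmulfV mulg_eq1 eqg_inv => /eqP.
have g0M : {morph g0 : a b / a * b}.
  move=> a b; case: (qmap_surj a) (qmap_surj b) => x <- [y <-].
  by rewrite -qmapM !g0E gmulfM.
pose gH := isUMagmaMorphism.Build _ _ g0 (morph_hom g0M).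
pose g : ghom (quot S) T := HB.pack g0 gH.
by exists g.
Qed.

Definition subquot (G : groupType) (K : groupClosed G) (S : set G) : Type :=
  quot [set x : subgroup_type K | S (val x)].

HB.instance Definition _ (G : groupType) (K : groupClosed G) (S : set G) :=
  Group.on (subquot K S).

(* The free group on A: words in the letters (a, false) = a and
   (a, true) = a^-1, up to insertion and deletion of cancelling pairs. *)
Section FreeGroup.
Variable A : choiceType.

Inductive word_eq : seq (A * bool) -> seq (A * bool) -> Prop :=
| word_eq_refl u : word_eq u u
| word_eq_sym u v : word_eq u v -> word_eq v u
| word_eq_trans u v w : word_eq u v -> word_eq v w -> word_eq u w
| word_eq_cancel u a b v :
    word_eq (u ++ (a, b) :: (a, ~~ b) :: v) (u ++ v).

Definition word_rel : rel (seq (A * bool)) := fun u v => `[< word_eq u v >].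

Lemma word_rel_refl : reflexive word_rel.
Proof. by move=> u; apply/asboolP; exact: word_eq_refl. Qed.
Lemma word_rel_sym : symmetric word_rel.
Proof. by move=> u v; apply/asboolP/asboolP; exact: word_eq_sym. Qed.
Lemma word_rel_trans : transitive word_rel.
Proof.
by move=> v u w /asboolP uv /asboolP vw; apply/asboolP/(word_eq_trans uv vw).
Qed.

Canonical word_equiv :=
  EquivRel word_rel word_rel_refl word_rel_sym word_rel_trans.

Definition free_group : Type := {eq_quot word_rel}.

HB.instance Definition _ := Choice.on free_group.
HB.instance Definition _ := EqQuotient.on free_group.

Lemma free_eqP u v :
  reflect (\pi_free_group u = \pi_free_group v) `[< word_eq u v >].
Proof. exact: (@eqmodP _ word_equiv). Qed.

Lemma free_reprP u : word_eq (repr (\pi_free_group u)) u.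
Proof. by apply/asboolP/free_eqP; rewrite reprK. Qed.

Lemma word_eq_cat u u' v v' :
  word_eq u u' -> word_eq v v' -> word_eq (u ++ v) (u' ++ v').
Proof.
move=> uu' vv'; apply: (@word_eq_trans _ (u' ++ v)).
  elim: uu' => [?|*|? ? ? _ h1 _ h2|*]; [exact: word_eq_refl|exact: word_eq_sym|
    exact: word_eq_trans h1 h2|rewrite -!catA; exact: word_eq_cancel].
elim: vv' => [?|*|? ? ? _ h1 _ h2|*]; [exact: word_eq_refl|exact: word_eq_sym|
    exact: word_eq_trans h1 h2|rewrite !catA; exact: word_eq_cancel].
Qed.

Definition word_inv (u : seq (A * bool)) : seq (A * bool) :=
  rev [seq (p.1, ~~ p.2) | p <- u].

Lemma word_invK : involutive word_inv.
Proof.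
move=> u; rewrite /word_inv map_rev revK -map_comp -[RHS]map_id.
by apply: eq_map => -[a b] /=; rewrite negbK.
Qed.

Lemma word_eq_inv u v : word_eq u v -> word_eq (word_inv u) (word_inv v).
Proof.
elim=> [?|*|? ? ? _ h1 _ h2|{}u a b {}v]; [exact: word_eq_refl|
  exact: word_eq_sym|exact: word_eq_trans h1 h2|].
rewrite /word_inv !map_cat !rev_cat /= !rev_cons -!cats1 -!catA /= negbK.
by have := @word_eq_cancel (rev [seq (p.1, ~~ p.2) | p <- v]) a b
  (rev [seq (p.1, ~~ p.2) | p <- u]).
Qed.

Lemma word_mulV u : word_eq (u ++ word_inv u) [::].
Proof.
elim/last_ind: u => [|u [a b] IH]; first exact: word_eq_refl.
apply: word_eq_trans IH; rewrite /word_inv map_rcons rev_rcons -cats1 -catA /=.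
exact: word_eq_cancel.
Qed.

Definition free_mul (x y : free_group) : free_group :=
  \pi_free_group (repr x ++ repr y).
Definition free_one : free_group := \pi_free_group [::].
Definition free_inv (x : free_group) : free_group :=
  \pi_free_group (word_inv (repr x)).

Lemma free_piM u v :
  free_mul (\pi_free_group u) (\pi_free_group v) = \pi_free_group (u ++ v).
Proof. by apply/free_eqP/asboolP; apply: word_eq_cat; exact: free_reprP. Qed.

Lemma free_piV u : free_inv (\pi_free_group u) = \pi_free_group (word_inv u).
Proof. by apply/free_eqP/asboolP; apply: word_eq_inv; exact: free_reprP. Qed.

Lemma free_pi_surj x : exists u, \pi_free_group u = x.
Proof. by exists (repr x); rewrite reprK. Qed.

Lemma free_mulA : associative free_mul.
Proof.
move=> x y z; case: (free_pi_surj x) (free_pi_surj y) (free_pi_surj z).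
by move=> u <- [v <-] [w <-]; rewrite !free_piM catA.
Qed.
Lemma free_mul1 : left_id free_one free_mul.
Proof. by move=> x; case: (free_pi_surj x) => u <-; rewrite free_piM. Qed.
Lemma free_mulr1 : right_id free_one free_mul.
Proof.
by move=> x; case: (free_pi_surj x) => u <-; rewrite free_piM cats0.
Qed.
Lemma free_mulVr : right_inverse free_one free_inv free_mul.
Proof.
move=> x; case: (free_pi_surj x) => u <-; rewrite free_piV free_piM.
by apply/free_eqP/asboolP; exact: word_mulV.
Qed.
Lemma free_mulV : left_inverse free_one free_inv free_mul.
Proof.
move=> x; case: (free_pi_surj x) => u <-; rewrite free_piV free_piM.
by apply/free_eqP/asboolP; rewrite -{2}[u]word_invK; exact: word_mulV.
Qed.

HB.instance Definition _ := isGroup.Build free_group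
  free_mulA free_mul1 free_mulr1 free_mulV free_mulVr.

Definition fgen (a : A) : free_group := \pi_free_group [:: (a, false)].

Lemma free_ind (P : free_group -> Prop) :
  P 1 -> (forall a x, P x -> P (fgen a * x)) ->
  (forall a x, P x -> P ((fgen a)^-1 * x)) -> forall x, P x.
Proof.
move=> P1 PM PV x; case: (free_pi_surj x) => u <- {x}.
have piM v w : \pi_free_group v * \pi_free_group w = \pi_free_group (v ++ w).
  exact: free_piM.
have piV v : (\pi_free_group v)^-1 = \pi_free_group (word_inv v).
  exact: free_piV.
elim: u => [//|[a []] u IH].
  by have := PV a _ IH; rewrite /fgen piV piM.
by have := PM a _ IH; rewrite /fgen piM.
Qed.

Lemma free_ext (T : groupType) (f g : ghom free_group T) :
  (forall a, f (fgen a) = g (fgen a)) -> f =1 g.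
Proof.
move=> fg; apply: free_ind => [|a x IH|a x IH]; first by rewrite !gmulf1.
  by rewrite !gmulfM IH fg.
by rewrite !gmulfM !gmulfV IH fg.
Qed.

Section Lift.
Variables (T : groupType) (f : A -> T).

Definition word_eval (u : seq (A * bool)) : T :=
  \prod_(p <- u) (if p.2 then (f p.1)^-1 else f p.1).

Lemma word_eval_eq u v : word_eq u v -> word_eval u = word_eval v.
Proof.
elim=> [//|? ? _ -> //|? ? ? _ -> _ -> //|{}u a b {}v].
rewrite /word_eval !big_cat !big_cons /=; congr (_ * _); rewrite mulgA.
by case: b; rewrite /= ?mulVg ?mulgV mul1g.
Qed.

Definition free_lift (x : free_group) : T := word_eval (repr x).

Lemma free_liftM : {morph free_lift : x y / x * y}.
Proof.
move=> x y; rewrite {1}/free_lift (word_eval_eq (free_reprP _)).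
by rewrite /word_eval big_cat.
Qed.
HB.instance Definition _ :=
  isUMagmaMorphism.Build free_group T free_lift (morph_hom free_liftM).

Lemma free_liftE a : free_lift (fgen a) = f a.
Proof.
by rewrite /free_lift (word_eval_eq (free_reprP _)) /word_eval big_seq1.
Qed.

End Lift.

End FreeGroup.

(* The free product, presented by the multiplication tables of its factors. *)
Section FreeProduct.
Variables X Y : groupType.

Definition freeprod_rel : set (free_group (X + Y)%type) :=
  [set w | (exists x x' : X,
              w = fgen (inl x) * fgen (inl x') * (fgen (inl (x * x')))^-1) \/
           (exists y y' : Y,
              w = fgen (inr y) * fgen (inr y') * (fgen (inr (y * y')))^-1)].

Definition freeprod : Type := quot freeprod_rel.
HB.instance Definition _ := Group.on freeprod.

Definition finl (x : X) : freeprod := qmap freeprod_rel (fgen (inl x)).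
Definition finr (y : Y) : freeprod := qmap freeprod_rel (fgen (inr y)).

Lemma finlM : {morph finl : x y / x * y}.
Proof.
move=> x x'; apply: etrans (qmapM _ _ _); apply/esym/qmap_eq.
by apply: normal_closure_sub; left; exists x, x'.
Qed.
HB.instance Definition _ :=
  isUMagmaMorphism.Build X freeprod finl (morph_hom finlM).

Lemma finrM : {morph finr : x y / x * y}.
Proof.
move=> y y'; apply: etrans (qmapM _ _ _); apply/esym/qmap_eq.
by apply: normal_closure_sub; right; exists y, y'.
Qed.
HB.instance Definition _ :=
  isUMagmaMorphism.Build Y freeprod finr (morph_hom finrM).

Lemma freeprod_lift (T : groupType) (f : ghom X T) (g : ghom Y T) :
  exists h : ghom freeprod T,
    (forall x, h (finl x) = f x) /\ (forall y, h (finr y) = g y).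
Proof.
pose e (a : X + Y) := match a with inl x => f x | inr y => g y end.
have [|h hE] := @quot_lift _ _ freeprod_rel (free_lift e).
  have eE a : (free_lift e : ghom _ _) (fgen a) = e a := free_liftE e a.
  by move=> w [|] [x [x' ->]]; rewrite /= inE gmulfF gmulfM !eE /= gmulfM divgg.
by exists h; split=> x; rewrite hE; exact: free_liftE.
Qed.

Lemma freeprod_ind (P : freeprod -> Prop) :
  P 1 -> (forall x a, P a -> P (finl x * a)) ->
  (forall y a, P a -> P (finr y * a)) -> forall a, P a.
Proof.
move=> P1 PL PR a; case: (qmap_surj a) => w <- {a}.
elim/free_ind: w => [|[x|y] w IH|[x|y] w IH].
- by rewrite gmulf1; exact: P1.
- by rewrite qmapM; exact: PL.
- by rewrite qmapM; exact: PR.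
- rewrite gmulfM gmulfV; have := PL x^-1 _ IH; rewrite gmulfV; exact.
- rewrite gmulfM gmulfV; have := PR y^-1 _ IH; rewrite gmulfV; exact.
Qed.

Lemma freeprod_ext (T : groupType) (h h' : ghom freeprod T) :
  (forall x, h (finl x) = h' (finl x)) ->
  (forall y, h (finr y) = h' (finr y)) -> h =1 h'.
Proof.
move=> hl hr; apply: freeprod_ind => [|x a IH|y a IH].
- by rewrite !gmulf1.
- by rewrite !gmulfM IH hl.
- by rewrite !gmulfM IH hr.
Qed.

End FreeProduct.

(* The isomorphic copy X^* is X itself, embedded in X * X^* by finr. *)
Section Nu.
Variable X : groupType.

Definition nu_rel : set (freeprod X X) :=
  [set w | exists x y z : X,
     let xy := [~ finl X x, finr X y] in
     let xyz := [~ finl X (x ^ z), finr X (y ^ z)] in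
     w = xy ^ finl X z * xyz^-1 \/ w = xy ^ finr X z * xyz^-1].

Definition nu : Type := quot nu_rel.
HB.instance Definition _ := Group.on nu.

Definition nuL (x : X) : nu := qmap nu_rel (finl X x).
Definition nuR (x : X) : nu := qmap nu_rel (finr X x).

Lemma nuLM : {morph nuL : x y / x * y}.
Proof. by move=> x y; rewrite /nuL gmulfM qmapM. Qed.
HB.instance Definition _ := isUMagmaMorphism.Build X nu nuL (morph_hom nuLM).

Lemma nuRM : {morph nuR : x y / x * y}.
Proof. by move=> x y; rewrite /nuR gmulfM qmapM. Qed.
HB.instance Definition _ := isUMagmaMorphism.Build X nu nuR (morph_hom nuRM).

Lemma nuLJ x y z : [~ nuL x, nuR y] ^ nuL z = [~ nuL (x ^ z), nuR (y ^ z)].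
Proof.
rewrite /nuL /nuR -!gmulfR -gmulfJ; apply: qmap_eq; apply: normal_closure_sub.
by exists x, y, z; left.
Qed.

Lemma nuRJ x y z : [~ nuL x, nuR y] ^ nuR z = [~ nuL (x ^ z), nuR (y ^ z)].
Proof.
rewrite /nuL /nuR -!gmulfR -gmulfJ; apply: qmap_eq; apply: normal_closure_sub.
by exists x, y, z; right.
Qed.

Lemma nu_ind (P : nu -> Prop) :
  P 1 -> (forall x a, P a -> P (nuL x * a)) ->
  (forall x a, P a -> P (nuR x * a)) -> forall a, P a.
Proof.
move=> P1 PL PR a; case: (qmap_surj a) => w <- {a}.
elim/freeprod_ind: w => [|x w IH|x w IH].
- by rewrite gmulf1; exact: P1.
- by rewrite qmapM; exact: PL.
- by rewrite qmapM; exact: PR.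
Qed.

Definition nabla : {pred nu} := gen [set [~ nuL x, nuR x] | x in [set: X]].

Lemma nabla_normal : conj_stable [set` nabla].
Proof.
move=> w a /=; elim/nu_ind: a w => [w|x a IH w wN|x a IH w wN].
- by rewrite conjg1.
- rewrite conjgM IH//; apply: gen_conj wN => _ [y _ <-].
  by rewrite nuLJ; apply: gen_sub; exists (y ^ x).
- rewrite conjgM IH//; apply: gen_conj wN => _ [y _ <-].
  by rewrite nuRJ; apply: gen_sub; exists (y ^ x).
Qed.

Definition tau : Type := quot [set` nabla].
HB.instance Definition _ := Group.on tau.

Definition tauL (x : X) : tau := qmap [set` nabla] (nuL x).
Definition tauR (x : X) : tau := qmap [set` nabla] (nuR x).

Definition Mflat : {pred tau} :=
  gen [set w | exists x y : X, [~ x, y] = 1 /\ w = [~ tauL x, tauR y]].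

Lemma Mflat_normal : conj_stable [set` Mflat].
Proof.
have LE z : tauL z = qmap [set` nabla] (nuL z) by [].
have RE z : tauR z = qmap [set` nabla] (nuR z) by [].
move=> w a /=; case: (qmap_surj a) => b <- {a}.
elim/nu_ind: b w => [w|x a IH w wN|x a IH w wN].
- by rewrite gmulf1 conjg1.
- rewrite gmulfM conjgM IH//; apply: gen_conj wN => _ [y [z [yz ->]]].
  apply: gen_sub; exists (y ^ x), (z ^ x); rewrite -conjRg yz conj1g.
  by rewrite !LE !RE -!gmulfR -gmulfJ nuLJ.
- rewrite gmulfM conjgM IH//; apply: gen_conj wN => _ [y [z [yz ->]]].
  apply: gen_sub; exists (y ^ x), (z ^ x); rewrite -conjRg yz conj1g.
  by rewrite !LE !RE -!gmulfR -gmulfJ nuRJ.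
Qed.

Definition tauflat : Type := quot [set` Mflat].
HB.instance Definition _ := Group.on tauflat.

Definition tauflatL (x : X) : tauflat := qmap [set` Mflat] (tauL x).
Definition tauflatR (x : X) : tauflat := qmap [set` Mflat] (tauR x).

End Nu.

Lemma derived_full_normal (G : groupType) :
  conj_stable [set` derived (full G)].
Proof.
move=> x y /= xG; rewrite -(mulKVg x (x ^ y)) gpredM// gen_sub//.
by exists x, y.
Qed.

Lemma abelianization_comm (G : groupType) (a b : quot [set` derived (full G)]) :
  a * b = b * a.
Proof.
case: (qmap_surj a) (qmap_surj b) => x <- [y <-]; rewrite -!qmapM.
apply: qmap_eq; apply: normal_closure_sub => /=.
rewrite (_ : _ / _ = [~ x^-1, y^-1]); last first.
  by rewrite /commg /conjg !invgK invgM !mulgA.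
by apply: gen_sub; exists x^-1, y^-1.
Qed.

Section FiberProduct.
Variables (F : groupType) (n : nat).

(* K(X, n) for a subgroup X of F, as a subset of F^n. *)
Definition Kset (X : {pred F}) : {pred {ffun 'I_n -> F}} :=
  [pred g : {ffun 'I_n -> F} |
     [forall i, g i \in X] && (\prod_(i < n) g i \in derived X)].

Let q : ghom F _ := qmap [set` derived (full F)].

Lemma Kset_fullE g : (g \in Kset (full F)) = (\prod_(i < n) q (g i) == 1).
Proof.
rewrite -gmulf_prod qmap_ker normal_closure_id; last exact: derived_full_normal.
by rewrite inE andbC; case: (_ \in _) => //=; apply/forallP.
Qed.

Lemma prod_qmapF (g h : {ffun 'I_n -> F}) :
  \prod_(i < n) q ((g / h) i) = (\prod_(i < n) q (g i)) / \prod_(i < n) q (h i).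
Proof.
elim/big_rec3: _ => [|i a b c _ ->]; first by rewrite divg1.
rewrite !ffunE gmulfF invgM -!mulgA; congr (_ * _).
by rewrite abelianization_comm -mulgA.
Qed.

Lemma Kset_full_closed : group_closed (Kset (full F)).
Proof.
split=> [|g h]; rewrite !Kset_fullE.
  by rewrite big1// => i _; rewrite ffunE gmulf1.
by move=> /eqP g1 /eqP h1; rewrite prod_qmapF g1 h1 divgg.
Qed.
HB.instance Definition _ :=
  isMulClosed.Build _ (Kset (full F)) (group_closedM Kset_full_closed).
HB.instance Definition _ :=
  isMul1Closed.Build _ (Kset (full F)) Kset_full_closed.1.
HB.instance Definition _ :=
  isInvClosed.Build _ (Kset (full F)) (group_closedV Kset_full_closed).

End FiberProduct.

Arguments Kset {F} n X.

Lemma Kset_ker_sub (F G : groupType) (p : ghom F G) (n : nat) :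
  {subset normal_closure [set` Kset n (ker p)] <= Kset n (full F)}.
Proof.
move=> g /normal_closureP; apply=> [{}g h /=|{}g /= /andP[_ g1]].
  rewrite !Kset_fullE => /eqP g1; apply/eqP.
  rewrite -{}[RHS]g1; apply: eq_bigr => i _; rewrite !ffunE.
  by rewrite gmulfM gmulfM gmulfV abelianization_comm mulgK.
rewrite inE; apply/andP; split; first exact/forallP.
move/genP: g1; apply => w [x [y [_ _ ->]]] /=.
by apply: gen_sub; exists x, y.
Qed.

(* The group K(F, n) / K(N, n)^(F^n) attached to F -> F / N = G. *)
Definition Ktilde (F G : groupType) (p : ghom F G) (n : nat) : Type :=
  subquot (Kset n (full F)) [set` normal_closure [set` Kset n (ker p)]].
HB.instance Definition _ (F G : groupType) (p : ghom F G) (n : nat) :=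
  Group.on (Ktilde p n).

Section UnitGroup.
Variable A : comUnitRingType.

Definition unit_group : Type := {x : A | x \is a GRing.unit}.
HB.instance Definition _ := SubChoice.on unit_group.

Definition ug_mul (x y : unit_group) : unit_group :=
  exist _ (val x * val y)%R (etrans (GRing.unitrMl _ (valP y)) (valP x)).
Definition ug_one : unit_group := exist _ 1%R (GRing.unitr1 A).
Definition ug_inv (x : unit_group) : unit_group :=
  exist _ (val x)^-1%R (etrans (GRing.unitrV _) (valP x)).

Lemma ug_mulA : associative ug_mul.
Proof. by move=> x y z; apply: val_inj; rewrite /= GRing.mulrA. Qed.
Lemma ug_mulC : commutative ug_mul.
Proof. by move=> x y; apply: val_inj; rewrite /= GRing.mulrC. Qed.
Lemma ug_mul1 : left_id ug_one ug_mul.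
Proof. by move=> x; apply: val_inj; rewrite /= GRing.mul1r. Qed.
Lemma ug_mulr1 : right_id ug_one ug_mul.
Proof. by move=> x; rewrite ug_mulC ug_mul1. Qed.
Lemma ug_mulV : left_inverse ug_one ug_inv ug_mul.
Proof. by move=> x; apply: val_inj; rewrite /= GRing.mulVr ?(valP x). Qed.
Lemma ug_mulVr : right_inverse ug_one ug_inv ug_mul.
Proof. by move=> x; rewrite ug_mulC ug_mulV. Qed.

HB.instance Definition _ := isGroup.Build unit_group
  ug_mulA ug_mul1 ug_mulr1 ug_mulV ug_mulVr.

End UnitGroup.

(* H^2(G, C^x) with trivial action, as 2-cocycles modulo 2-coboundaries. *)
Section SchurMultiplier.
Variables (R : realType) (G : finGroupType).

Let Cx := unit_group R[i].

Definition cocycle2 : {pred {ffun G * G -> Cx}} :=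
  [pred c : {ffun G * G -> Cx} | [forall x, forall y, forall z,
     c (x, y) * c (x * y, z) == c (y, z) * c (x, y * z)]].

Definition coboundary2 : set {ffun G * G -> Cx} :=
  [set c | exists t : {ffun G -> Cx},
     forall x y, c (x, y) = t x * t y * (t (x * y))^-1].

Lemma cocycle2P (c : {ffun G * G -> Cx}) :
  reflect (forall x y z, c (x, y) * c (x * y, z) = c (y, z) * c (x, y * z))
          (c \in cocycle2).
Proof.
by apply: (iffP forallP) => cc x; [move=> y z|];
   [move/forallP/(_ y)/forallP/(_ z)/eqP: (cc x)|
    apply/forallP => y; apply/forallP => z; apply/eqP].
Qed.

Lemma cocycle2_closed : group_closed cocycle2.
Proof.
have C : commutative (@mul Cx) := @ug_mulC _.
split=> [|c d /cocycle2P cP /cocycle2P dP]; apply/cocycle2P => x y z.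
  by rewrite !ffunE.
rewrite !ffunE.
have E (a b u v : Cx) : a / b * (u / v) = (a * u) / (b * v).
  rewrite (C b v) invgM -!mulgA; congr (_ * _).
  by rewrite C -!mulgA; congr (_ * _); exact: C.
by rewrite !E cP dP.
Qed.
HB.instance Definition _ :=
  isMulClosed.Build _ cocycle2 (group_closedM cocycle2_closed).
HB.instance Definition _ := isMul1Closed.Build _ cocycle2 cocycle2_closed.1.
HB.instance Definition _ :=
  isInvClosed.Build _ cocycle2 (group_closedV cocycle2_closed).

Definition schur_multiplier : Type := subquot cocycle2 coboundary2.
HB.instance Definition _ := Group.on schur_multiplier.

End SchurMultiplier.

Record schur_cover (R : realType) (G : finGroupType) (H : groupType)
    (M : groupClosed H) : Prop := SchurCover {
  schur_cover_quot : isomorphic (quot [set` M]) G;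
  schur_cover_derived : {subset M <= derived (full H)};
  schur_cover_center : {subset M <= center H};
  schur_cover_multiplier : isomorphic (subgroup_type M) (schur_multiplier R G)
}.

Definition AI_automorphism (H : groupType) (alpha : ghom H H) : Prop :=
  bijective alpha /\
  let ab := qmap [set` derived (full H)] in
  forall x, ab (alpha x) = (ab x)^-1.

(* Main.v *)
Require Import Defs.
From mathcomp Require Import ring.
From HB Require Import structures.
From mathcomp Require Import all_boot all_order all_algebra.
From mathcomp Require Import fingroup.
From mathcomp Require Import all_classical reals.
From mathcomp Require Import complex.

Set Implicit Arguments.
Unset Strict Implicit.
Unset Printing Implicit Defensive.

Import Algebra.

Local Open Scope group_scope.
Local Open Scope classical_set_scope.

(** Put T = tauflat H, and let x /\ y stand for the commutator of x and y^*
    in T.  The assignment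
      x |-> (x, alpha x, 1),   y^* |-> (1, alpha y, y)
    respects the relations of T, because it sends x /\ y to (1, alpha [x, y],
    1); it defines a morphism Psi : T -> H^3.  As alpha inverts the
    abelianisation, Psi lands in K(H, 3), and it is onto K(H, 3).  If Psi is
    also injective, everything follows: iota (m1, m2) has to be the preimage
    of the central triple (m1, (m1 m2)^-1, m2), the formula for iota is
    checked by applying Psi, and the range of iota corresponds to the triples
    of elements of M with product 1.  A lift phi : F -> H of p : F -> G, with
    N the kernel of p, is onto, since M <= H', and applied coordinatewise it
    maps K(F, 3) onto K(H, 3); the preimage of these triples is the normal
    closure of K(N, 3).

    Injectivity of Psi and the last assertion rest on two facts.

    (1) Hopf formula for the cover: an element of F' killed by phi lies in
    [N, F].  Each relator b in F' and each 2-cocycle c determine the number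
    t(b) c(1,1), where t : F -> C^x satisfies t(xy) = t(x) t(y) c(p x, p y);
    such a t exists because F is free, and it is unique on F'.  This
    evaluates classes of H^2(G, C^x) at b, and two relators which differ
    modulo [N, F] give different characters of H^2(G, C^x), since the
    characters of the abelian group N / [N, F] separate points (C^x is
    divisible).  The group H^2(G, C^x) is finite, and a finite group D has at
    most |D| characters; so N \cap F' has at most |M| classes modulo [N, F].
    As phi maps these classes onto M, it is injective on them.  See
    [schur_cover_lift_inj].

    (2) For F free there are a group P containing T and a morphism s : F -> P
    such that [s x, s y] = phi x /\ phi y for all x, y.  It suffices to have
    this for the generators of F, and P is obtained by adjoining to T one
    element for each generator: if q : P -> H is compatible with the map T ->
    H that forgets the star, then u |-> u (q u /\ z) is an action of H on P
    by automorphisms, and in the semidirect product the element e of H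
    satisfies [u, e] = q u /\ e.  See [crossed_ext_step] and
    [crossed_ext_free].

    Now let Psi t = 1.  Writing t = x y^* w with w a product of elements a /\
    b, one gets x = y = 1.  By (2), w = s f for some f in F' with phi f = 1.
    By (1), f lies in [N, F], and s kills [N, F] because [s n, s x] = phi n
    /\ phi x with phi n central, and the wedge of commuting elements is
    trivial in T.  Hence w = 1. *)

(** * Group identities and induction principles *)

Section GroupIdentities.
Variable G : groupType.
Implicit Types x y z t : G.

Lemma commgMl x y z : [~ x * y, z] = [~ x, z] ^ y * [~ y, z].
Proof. by rewrite /commg /conjg !invgM !mulgA !mulgK. Qed.

Lemma commgMr x y z : [~ x, y * z] = [~ x, z] * [~ x, y] ^ z.
Proof. by rewrite /commg /conjg !invgM !mulgA !mulgK. Qed.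

Lemma commute_mulACA x y z t : commute y z -> x * y * (z * t) = x * z * (y * t).
Proof. by move=> yz; rewrite -!mulgA (mulgA y) yz -mulgA. Qed.

End GroupIdentities.

Section AbelianIdentities.
Variable B : groupType.
Hypothesis BC : forall x y : B, x * y = y * x.

Lemma abel_mulACA (x y z t : B) : x * y * (z * t) = x * z * (y * t).
Proof. exact/commute_mulACA/BC. Qed.

Lemma abel_cancel (a b d u v w k : B) :
  a * (b * d * k) * w = a * b * v * d * u -> v * u = k * w.
Proof.
move=> E; apply: (mulgI (a * b * d)); transitivity (a * b * v * d * u).
  by rewrite -!mulgA; do 2!congr (_ * _); rewrite !mulgA (BC d).
by rewrite -E !mulgA.
Qed.

End AbelianIdentities.

(** Induction on the subgroup generated by S. *)
Lemma gen_rec (G : groupType) (S P : set G) :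
  P 1 -> (forall x y, P x -> P y -> P (x * y)) ->
  (forall x, P x -> P x^-1) -> S `<=` P ->
  forall x, x \in gen S -> P x.
Proof.
move=> P1 PM PV SP x /genP xS.
pose K : {pred G} := fun z => `[< P z >].
have KM : mulg_closed K by move=> u v /asboolP Pu /asboolP Pv; apply/asboolP/PM.
have K1 : 1 \in K by apply/asboolP.
have KV : invg_closed K by move=> u /asboolP Pu; apply/asboolP/PV.
pose kM := isMulClosed.Build G K KM.
pose k1 := isMul1Closed.Build G K K1.
pose kV := isInvClosed.Build G K KV.
pose k : groupClosed G := HB.pack K kM k1 kV.
by apply/asboolP/(xS k) => y Sy; apply/asboolP/SP.
Qed.

(** Induction on the normal closure of S. *)
Lemma normal_closure_rec (G : groupType) (S P : set G) :
  P 1 -> (forall x y, P x -> P y -> P (x * y)) ->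
  (forall x, P x -> P x^-1) -> conj_stable P -> S `<=` P ->
  forall x, x \in normal_closure S -> P x.
Proof.
move=> P1 PM PV PJ SP x /normal_closureP xS.
pose K : {pred G} := fun z => `[< P z >].
have KM : mulg_closed K by move=> u v /asboolP Pu /asboolP Pv; apply/asboolP/PM.
have K1 : 1 \in K by apply/asboolP.
have KV : invg_closed K by move=> u /asboolP Pu; apply/asboolP/PV.
pose kM := isMulClosed.Build G K KM.
pose k1 := isMul1Closed.Build G K K1.
pose kV := isInvClosed.Build G K KV.
pose k : groupClosed G := HB.pack K kM k1 kV.
apply/asboolP/(xS k) => y => [z|Sy]; last exact/asboolP/SP.
by move=> /asboolP Py; apply/asboolP/PJ.
Qed.

(** * Calculus of the commutators of a group with its copy *)

Section Wedge.
Variables (H T : groupType) (L R : ghom H T).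
Implicit Types (x y z : H).

(** The commutator of x, taken in the first copy of H, and y, taken in the
    second one. *)
Definition wedge x y : T := [~ L x, R y].

Hypothesis wedgeJL : forall x y z, wedge x y ^ L z = wedge (x ^ z) (y ^ z).
Hypothesis wedgeJR : forall x y z, wedge x y ^ R z = wedge (x ^ z) (y ^ z).
Hypothesis wedge_refl : forall x, wedge x x = 1.

Lemma wedgeMl x y z : wedge (x * y) z = wedge (x ^ y) (z ^ y) * wedge y z.
Proof. by rewrite /wedge gmulfM commgMl wedgeJL. Qed.

Lemma wedgeMr x y z : wedge x (y * z) = wedge x z * wedge (x ^ z) (y ^ z).
Proof. by rewrite /wedge gmulfM commgMr wedgeJR. Qed.

Lemma wedge1r x : wedge x 1 = 1.
Proof. by rewrite /wedge gmulf1 commg1. Qed.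

Lemma wedgeV x y : (wedge x y)^-1 = wedge y x.
Proof.
apply: mulg1_eq; rewrite -(conjgKV y x); move: (x ^ y^-1) => {x} u.
have yy : y ^ y = y by rewrite conjgE mulKg.
have := wedge_refl (u * y);
  rewrite wedgeMl conjMg yy (wedgeMr (u ^ y)) (wedgeMr y) yy.
by rewrite !wedge_refl mul1g mulg1.
Qed.

(** In the left argument, conjugating by either copy of y gives the same
    wedges, although L y and R y are different elements. *)
Lemma wedge_conjl x y z : wedge (x ^ y) z = [~ L x ^ R y, R z].
Proof. by rewrite -(conjgKV y z) -wedgeJR /wedge conjRg -!gmulfJ. Qed.

Lemma wedge_assoc x y z : wedge x y * wedge (x ^ y) z = wedge x (y * z).
Proof.
rewrite wedge_conjl -[L x ^ R y](mulKVg (L x)) -commgEl -/(wedge x y).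
rewrite commgMl -/(wedge x z) mulgA -conjgC -mulgA.
by rewrite commgEl mulKVg wedgeJR -wedgeMr.
Qed.

(** The boundary of the wedge of x and y is [~ x, y]: taking the wedge of the
    boundary with z is the same as commuting with z. *)
Lemma wedge_commgl x y z :
  wedge x y * wedge [~ x, y] z = wedge (x ^ z) (y ^ z).
Proof.
have act u v : wedge u v ^ [~ L x, R y] = wedge (u ^ [~ x, y]) (v ^ [~ x, y]).
  by rewrite !conjgM -!gmulfV !(wedgeJL, wedgeJR).
have Vx : (wedge x z)^-1 = wedge x^-1 (z ^ x).
  have := wedgeMl x^-1 x z.
  rewrite mulVg {1}/wedge gmulf1 comm1g [x^-1 ^ x]conjgE mulVg mulg1.
  by move=> /esym/mulg1_eq <-; rewrite invgK.
have {1}-> : [~ x, y] = x^-1 * x ^ y by [].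
have xyE : x ^ y = x * [~ x, y] by rewrite commgEl mulKVg.
rewrite wedgeMl {1 2}xyE conjgM [x^-1 ^ x]conjgE mulVg mulg1 conjgM -act -Vx.
by rewrite mulgA -conjgC -mulgA wedge_assoc wedgeMr mulKg.
Qed.

End Wedge.

(** * Adjoining elements with prescribed commutators *)

(** Right actions of a group by automorphisms. *)
Record right_action (P H : groupType) (A : H -> P -> P) : Prop := RightAction {
  ra_M : forall z, {morph A z : u v / u * v};
  ra_1 : forall u, A 1 u = u;
  ra_A : forall y z u, A (y * z) u = A z (A y u) }.

(** The semidirect product for a right action: the pair (u, y) stands for the
    product y * u, so that conjugation of u by y is A y u. *)
Definition semidirect (P H : groupType) (A : H -> P -> P) of right_action A :
  Type := (P * H)%type.

Section Semidirect.
Variables (P H : groupType) (A : H -> P -> P) (hA : right_action A).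
Local Notation sd := (semidirect hA).

HB.instance Definition _ := Choice.on sd.

Definition sd_mul (a b : sd) : sd :=
  (A b.2 a.1 * b.1, a.2 * b.2).
Definition sd_one : sd := (1, 1).
Definition sd_inv (a : sd) : sd := (A a.2^-1 a.1^-1, a.2^-1).

Let Aone z : A z 1 = 1.
Proof. by apply: (mulgI (A z 1)); rewrite -(ra_M hA) !mulg1. Qed.

Lemma sd_mulA : associative sd_mul.
Proof. by move=> a b c; rewrite /sd_mul /= (ra_M hA) (ra_A hA) !mulgA. Qed.
Lemma sd_mul1 : left_id sd_one sd_mul.
Proof. by case=> u y; rewrite /sd_mul /= Aone !mul1g. Qed.
Lemma sd_mulr1 : right_id sd_one sd_mul.
Proof. by case=> u y; rewrite /sd_mul /= (ra_1 hA) !mulg1. Qed.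
Lemma sd_mulV : left_inverse sd_one sd_inv sd_mul.
Proof. by case=> u y; rewrite /sd_mul /= -(ra_A hA) !mulVg (ra_1 hA) mulVg. Qed.
Lemma sd_mulVr : right_inverse sd_one sd_inv sd_mul.
Proof. by case=> u y; rewrite /sd_mul /= -(ra_M hA) !mulgV Aone. Qed.
HB.instance Definition _ := isGroup.Build sd
  sd_mulA sd_mul1 sd_mulr1 sd_mulV sd_mulVr.

Lemma sdE (a b : sd) : a * b = (A b.2 a.1 * b.1, a.2 * b.2).
Proof. by []. Qed.

Definition sdl (u : P) : sd := (u, 1).
Definition sdr (y : H) : sd := (1, y).

Lemma sdlM : {morph sdl : u v / u * v}.
Proof. by move=> u v; rewrite sdE /sdl /= (ra_1 hA) mulg1. Qed.
HB.instance Definition _ :=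
  isUMagmaMorphism.Build P sd sdl (morph_hom sdlM).

Lemma sdrM : {morph sdr : u v / u * v}.
Proof. by move=> u v; rewrite sdE /sdr /= Aone mulg1. Qed.
HB.instance Definition _ :=
  isUMagmaMorphism.Build H sd sdr (morph_hom sdrM).

Lemma sdlJ u z : sdl u ^ sdr z = sdl (A z u).
Proof.
by apply: (mulgI (sdr z)); rewrite -conjgC !sdE /sdl /sdr /= (ra_1 hA) !mulg1
  !mul1g.
Qed.

Lemma sd_split (a : sd) : a = sdr a.2 * sdl a.1.
Proof. by case: a => u y; rewrite sdE /sdl /sdr /= Aone mulg1 mul1g. Qed.

End Semidirect.

(** Two copies L and R of H that generate T, act in the same way on the
    wedges, satisfy [~ L x, R x] = 1, and are both split by q. *)
Record crossed_pair (H T : groupType) (L R : ghom H T) (q : ghom T H) : Prop :=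
  CrossedPair {
    cp_L : forall x y z, wedge L R x y ^ L z = wedge L R (x ^ z) (y ^ z);
    cp_R : forall x y z, wedge L R x y ^ R z = wedge L R (x ^ z) (y ^ z);
    cp_refl : forall x, wedge L R x x = 1;
    cp_ind : forall P : T -> Prop, P 1 -> (forall x a, P a -> P (L x * a)) ->
      (forall x a, P a -> P (R x * a)) -> forall a, P a;
    cp_qL : forall x, q (L x) = x;
    cp_qR : forall x, q (R x) = x }.

Section CrossedExtension.
Variables (H T : groupType) (L R : ghom H T) (q : ghom T H).
Hypothesis cp : crossed_pair L R q.

Lemma q_wedge x y : q (wedge L R x y) = [~ x, y].
Proof. by rewrite gmulfR (cp_qL cp) (cp_qR cp). Qed.

(** An overgroup j : T -> P of T, together with an extension of q to P
    through which P acts on the wedges. *)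
Record crossed_ext (P : groupType) (j : ghom T P) (qP : ghom P H) : Prop :=
  CrossedExt {
    ce_inj : injective j;
    ce_q : forall t, qP (j t) = q t;
    ce_J : forall v x y,
      j (wedge L R x y) ^ v = j (wedge L R (x ^ qP v) (y ^ qP v)) }.

Lemma crossed_ext0 : crossed_ext (idfun : ghom T T) q.
Proof.
split=> // v; elim/(cp_ind cp): v => [|z v IH|z v IH] x y /=.
- by rewrite gmulf1 !conjg1.
- by rewrite gmulfM !conjgM (cp_L cp) (cp_qL cp); exact: IH.
- by rewrite gmulfM !conjgM (cp_R cp) (cp_qR cp); exact: IH.
Qed.

Section Step.
Variables (P : groupType) (j : ghom T P) (qP : ghom P H).
Hypothesis ce : crossed_ext j qP.

(** An action of H on P, for which z acts on wedges as usual, and on the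
    first copy of H, sitting in T, as conjugation by R z does. *)
Definition ce_act (z : H) (u : P) : P := u * j (wedge L R (qP u) z).

Lemma qP_act z u : qP (ce_act z u) = qP u ^ z.
Proof. by rewrite gmulfM (ce_q ce) q_wedge commgEl mulKVg. Qed.

Lemma ce_actM z : {morph ce_act z : u v / u * v}.
Proof.
move=> u v; rewrite /ce_act [qP (u * v)]gmulfM (wedgeMl (cp_L cp)) [j (_ *
  _)]gmulfM -(ce_J ce) !mulgA.
by rewrite mulgK.
Qed.

Lemma ce_act1 u : ce_act 1 u = u.
Proof. by rewrite /ce_act wedge1r gmulf1 mulg1. Qed.

Lemma ce_actA y z u : ce_act (y * z) u = ce_act z (ce_act y u).
Proof.
rewrite [RHS]/ce_act qP_act {1}/ce_act -mulgA -gmulfM.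
by rewrite (wedge_assoc (cp_R cp)).
Qed.

Let ce_action : right_action ce_act := RightAction ce_actM ce_act1 ce_actA.
Let Q : groupType := semidirect ce_action.
Let l : ghom P Q := sdl ce_action.
Let r : ghom H Q := sdr ce_action.

(** The semidirect product for this action is a larger crossed extension, in
    which the adjoined element t over e satisfies [~ u, t] = q u /\ e. *)
Lemma crossed_ext_step (e : H) :
  exists (P' : groupType) (i : ghom P P') (j' : ghom T P') (q' : ghom P' H) (t
    : P'),
   [/\ crossed_ext j' q', forall w, j' w = i (j w), forall u, q' (i u) = qP u,
     q' t = e & forall u, [~ i u, t] = j' (wedge L R (qP u) e)].
Proof.
pose q0 (a : Q) : H := a.2 * qP a.1.
have q0M : {morph q0 : a b / a * b}.
  move=> a b; rewrite /q0 sdE /= gmulfM qP_act.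
  by rewrite mulgA -(mulgA a.2) -conjgC !mulgA.
pose qH := isUMagmaMorphism.Build _ _ q0 (morph_hom q0M).
pose q' : ghom Q H := HB.pack q0 qH.
pose j' : ghom T Q := l \o j.
have q'l u : q' (l u) = qP u by rewrite /= /q0 /= mul1g.
have q'r y : q' (r y) = y by rewrite /= /q0 /= gmulf1 mulg1.
have lr u z : l u ^ r z = l (ce_act z u) by exact: sdlJ.
exists Q, l, j', q', (r e); split=> //; last first.
- move=> u; rewrite commgEl lr -gmulfV -gmulfM /=.
  by rewrite /ce_act mulKg.
split.
- by move=> w w' /= [] /(ce_inj ce).
- by move=> w; rewrite q'l (ce_q ce).
have vE v : v = r v.2 * l v.1 by exact: sd_split.
move=> v x y; rewrite (vE v) conjgM; move: v.1 v.2 => {v} v w.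
rewrite [q' _]gmulfM q'l q'r !conjgM [j' _]/= lr.
rewrite /ce_act (ce_q ce) q_wedge -gmulfM (wedge_commgl (cp_L cp) (cp_R cp)).
by rewrite -gmulfJ (ce_J ce).
Qed.

End Step.

(** Iterating, any finite list of elements of H lifts to a crossed extension
    in such a way that the commutators of the lifts are wedges. *)
Lemma crossed_ext_gens (es : seq H) :
  exists (P : groupType) (j : ghom T P) (qP : ghom P H) (ts : seq P),
    [/\ crossed_ext j qP, [seq qP t | t <- ts] = es
      & {in ts &, forall t u, [~ t, u] = j (wedge L R (qP t) (qP u))}].
Proof.
elim: es => [|e es [P [j [qP [ts [ce tsE tsR]]]]]].
  by exists T, idfun, q, [::]; split=> //; exact: crossed_ext0.
have [P' [i [j' [q' [t [ce' j'E q'i q't it]]]]]] := crossed_ext_step ce e.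
exists P', j', q', (t :: [seq i u | u <- ts]); split=> //=.
  rewrite q't -tsE -map_comp; congr (_ :: _); exact: eq_map.
move=> a b; rewrite !inE => /orP[/eqP->|/mapP[u uts ->]]
  /orP[/eqP->|/mapP[v vts ->]].
- by rewrite commgg (cp_refl cp) gmulf1.
- rewrite -invgR it -gmulfV (wedgeV (cp_L cp) (cp_R cp) (cp_refl cp)).
  by rewrite q't q'i.
- by rewrite it q't q'i.
- by rewrite -gmulfR tsR// j'E !q'i.
Qed.

(** Lifting the images of the free generators gives a morphism s on the whole
    free group that computes wedges as commutators: both [~ s x, s y] and the
    wedge obey the same product rule in x. *)
Lemma crossed_ext_free (r : nat) (phi : ghom (free_group 'I_r) H) :
  exists (P : groupType) (j : ghom T P) (s : ghom (free_group 'I_r) P),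
    injective j /\ forall x y, [~ s x, s y] = j (wedge L R (phi x) (phi y)).
Proof.
have [P [j [qP [ts [ce tsE tsR]]]]] :=
  crossed_ext_gens [seq phi (fgen i) | i <- enum 'I_r].
have sz : size ts = r.
  by rewrite -(size_map qP) tsE size_map size_enum_ord.
pose s : ghom (free_group 'I_r) P := free_lift (fun i : 'I_r => nth 1 ts i).
have sE i : s (fgen i) = nth 1 ts i by exact: free_liftE.
have ts_in i : s (fgen i) \in ts by rewrite sE mem_nth// sz.
have qs : qP \o s =1 phi.
  apply: (@free_ext _ _ (qP \o s : ghom _ _) phi) => i /=; rewrite sE.
  rewrite -(nth_map _ (qP 1)) ?sz// tsE (nth_map i) ?size_enum_ord//.
  by rewrite nth_ord_enum.
have qsE x : qP (s x) = phi x by exact: qs.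
exists P, j, s; split; first exact: ce_inj ce.
have sJ x y v : j (wedge L R x y) ^ s v = j (wedge L R (x ^ phi v) (y ^ phi v)).
  by rewrite (ce_J ce) qsE.
pose C x y := [~ s x, s y] = j (wedge L R (phi x) (phi y)).
have C1 z : C 1 z by rewrite /C /wedge !gmulf1 !comm1g gmulf1.
have CM x y z : C x z -> C y z -> C (x * y) z.
  rewrite /C => xz yz.
  rewrite [s (x * y)]gmulfM [phi (x * y)]gmulfM commgMl xz yz sJ.
  by rewrite -[j _ * j _]gmulfM -(wedgeMl (cp_L cp)).
have CV x z : C x z -> C x^-1 z.
  rewrite /C => xz; apply: (conjg_inj (s x)); apply: (mulIg [~ s x, s z]).
  rewrite -commgMl -gmulfM mulVg gmulf1 comm1g xz sJ.
  by rewrite -[j _ * j _]gmulfM -(wedgeMl (cp_L cp)) -gmulfM mulVg /wedge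
    !gmulf1 comm1g gmulf1.
have CS x y : C x y -> C y x.
  rewrite /C => xy; rewrite -invgR xy.
  by rewrite -gmulfV (wedgeV (cp_L cp) (cp_R cp) (cp_refl cp)).
have Cgen x z : (forall a, C (fgen a) z) -> C x z.
  move=> Cz; elim/free_ind: x => [|a x IH|a x IH]; first exact: C1.
    exact: CM.
  by apply: CM => //; exact: CV.
move=> x y; apply: (Cgen) => a; apply/CS/Cgen => b;
  apply: etrans (tsR _ _ _ _) _ => //.
by rewrite !qsE.
Qed.
End CrossedExtension.

(** * The group tauflat H *)

Section TauFlat.
Variable H : groupType.
Local Notation T := (tauflat H).
Implicit Types (x y z : H).

Lemma tauflatLM : {morph (@tauflatL H) : x y / x * y}.
Proof. by move=> x y; rewrite /tauflatL /tauL !gmulfM. Qed.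
HB.instance Definition _ :=
  isUMagmaMorphism.Build H T (@tauflatL H) (morph_hom tauflatLM).

Lemma tauflatRM : {morph (@tauflatR H) : x y / x * y}.
Proof. by move=> x y; rewrite /tauflatR /tauR !gmulfM. Qed.
HB.instance Definition _ :=
  isUMagmaMorphism.Build H T (@tauflatR H) (morph_hom tauflatRM).

(** The two copies of H in tauflat H, bundled as morphisms, and their wedge. *)
Definition tfL : ghom H T := @tauflatL H.
Definition tfR : ghom H T := @tauflatR H.
Definition tfw := wedge tfL tfR.

Lemma tf_ind (P : T -> Prop) : P 1 -> (forall x a, P a -> P (tfL x * a)) ->
  (forall x a, P a -> P (tfR x * a)) -> forall a, P a.
Proof.
move=> P1 PL PR a; case: (qmap_surj a) => b <- {a};
  case: (qmap_surj b) => c <- {b}.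
elim/nu_ind: c => [|x a IH|x a IH].
- by rewrite !gmulf1; exact: P1.
- by rewrite !gmulfM; exact: PL.
- by rewrite !gmulfM; exact: PR.
Qed.

Lemma tfw_qmap x y :
  tfw x y = qmap [set` @Mflat H] (qmap [set` @nabla H] [~ nuL x, nuR y]).
Proof. by rewrite !gmulfR. Qed.

Lemma tfw_commute x y : commute x y -> tfw x y = 1.
Proof.
move=> xy; apply/eqP; rewrite /tfw /wedge /tfL /tfR /= /tauflatL /tauflatR.
rewrite -gmulfR qmap_ker; apply/normal_closure_sub/gen_sub.
by exists x, y; split=> //; exact/eqP/commgP.
Qed.

(** Universal property of tauflat H.  The last hypothesis also takes care of
    the elements [x, x^*]. *)
Lemma tf_lift (C : groupType) (f g : ghom H C) :
  (forall x y z, wedge f g x y ^ f z = wedge f g (x ^ z) (y ^ z)) ->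
  (forall x y z, wedge f g x y ^ g z = wedge f g (x ^ z) (y ^ z)) ->
  (forall x y, commute x y -> wedge f g x y = 1) ->
  exists h : ghom T C, (forall x, h (tfL x) = f x) /\ (forall x,
    h (tfR x) = g x).
Proof.
move=> fJ gJ fg1.
have [h0 [h0l h0r]] := freeprod_lift f g.
have [|h1 h1E] := @quot_lift _ _ (@nu_rel H) h0.
  move=> w [x [y [z [|] ->]]]; rewrite /= inE gmulfM gmulfV gmulfJ !gmulfR.
    by rewrite !(h0l, h0r) -/(wedge f g x y) fJ divgg.
  by rewrite !(h0l, h0r) -/(wedge f g x y) gJ divgg.
have h1L x : h1 (nuL x) = f x by rewrite h1E h0l.
have h1R x : h1 (nuR x) = g x by rewrite h1E h0r.
have [|h2 h2E] := @quot_lift _ _ [set` @nabla H] h1.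
  apply: (gen_rec (P := [set` ker h1])) => [|u v|u|_ [x _ <-]].
  - exact: gpred1.
  - exact: gpredM.
  - exact: gpredVr.
  by rewrite /= inE gmulfR h1L h1R -/(wedge f g x x) fg1.
have h2L x : h2 (tauL x) = f x by rewrite h2E h1L.
have h2R x : h2 (tauR x) = g x by rewrite h2E h1R.
have [|h3 h3E] := @quot_lift _ _ [set` @Mflat H] h2.
  apply: (gen_rec (P := [set` ker h2])) => [|u v|u|_ [x [y [xy ->]]]].
  - exact: gpred1.
  - exact: gpredM.
  - exact: gpredVr.
  rewrite /= inE gmulfR h2L h2R -/(wedge f g x y) fg1//.
  by apply/commgP; rewrite xy.
by exists h3; split=> x; rewrite h3E ?h2L ?h2R.
Qed.

Lemma tf_crossed_pair :
  exists q : ghom T H, crossed_pair tfL tfR q.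
Proof.
have [q [qL qR]] : exists h : ghom T H,
    (forall x, h (tfL x) = x) /\ (forall x, h (tfR x) = x).
  apply: (@tf_lift H idfun idfun); rewrite /wedge /=.
  - by move=> x y z; rewrite conjRg.
  - by move=> x y z; rewrite conjRg.
  - by move=> x y xy; apply/eqP/commgP.
exists q; split=> //.
- move=> x y z; rewrite -!/(tfw _ _) !tfw_qmap.
  by rewrite /tfL /= /tauflatL /tauL -!gmulfJ nuLJ.
- move=> x y z; rewrite -!/(tfw _ _) !tfw_qmap.
  by rewrite /tfR /= /tauflatR /tauR -!gmulfJ nuRJ.
- by move=> x; apply: tfw_commute.
- exact: tf_ind.
Qed.

(** The subgroup generated by all the wedges. *)
Definition tfW : {pred T} := gen [set w | exists x y, w = tfw x y].
HB.instance Definition _ := GroupClosed.on tfW.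

Lemma tf_split t : exists x y w, w \in tfW /\ t = tfL x * tfR y * w.
Proof.
have [q cp] := tf_crossed_pair.
elim/tf_ind: t => [|x _ [y [z [w [wW ->]]]]|x _ [y [z [w [wW ->]]]]].
- by exists 1, 1, 1; rewrite !gmulf1 !mulg1 gpred1.
- by exists (x * y), z, w; rewrite gmulfM !mulgA.
exists y, (x * z), (tfw (x ^ z) (y ^ z) * w); split.
  by rewrite gpredM//; apply: gen_sub; exists (x ^ z), (y ^ z).
have xyE : tfR x * tfL y = tfL y * tfR x * tfw x y.
  by rewrite -[tfw x y]invgK (wedgeV (cp_L cp) (cp_R cp) (cp_refl cp)) invgR
    -commgC.
rewrite -[tfw (x ^ z) _](cp_R cp) gmulfM mulgA -/(tfw x y).
move: (tfw x y) xyE => u xyE; move: (u ^ tfR z) (conjgC u (tfR z)) => v uv.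
by rewrite !mulgA xyE -!mulgA; do 2!congr (_ * _); rewrite !mulgA uv.
Qed.

End TauFlat.

Arguments tfL {H}.
Arguments tfR {H}.

(** * Characters with values in the units of a closed field *)

Section ScalarUnits.
Variable K : numClosedFieldType.
Local Notation U := (unit_group K).

Lemma ugM (x y : U) : val (x * y) = (val x * val y)%R. Proof. by []. Qed.
Lemma ug1 : val (1 : U) = 1%R. Proof. by []. Qed.
Lemma ugX (x : U) n : val (x ^+ n) = (val x ^+ n)%R.
Proof. by elim: n => [//|n IH]; rewrite expgS GRing.exprS ugM IH. Qed.
Lemma ug_neq0 (x : U) : val x != 0%R.
Proof. by rewrite -GRing.unitfE; exact: valP. Qed.
Lemma ugC (x y : U) : x * y = y * x. Proof. exact: ug_mulC. Qed.

Definition to_unit (z : K) (z0 : z != 0%R) : U :=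
  exist _ z (etrans (GRing.unitfE z) z0).

Lemma unit_root n (v : U) : (0 < n)%N -> exists z : U, z ^+ n = v.
Proof.
move=> n0; have [z zE] := GRing.solve_monicpoly n (fun i =>
  if i == 0%N then val v else 0%R : K) n0.
have {}zE : (z ^+ n)%R = val v.
  rewrite zE -(big_mkord xpredT (fun i =>
    ((if i == 0%N then val v else 0) * z ^+ i)%R)).
  rewrite big_ltn//= GRing.mulr1 big_nat big1 ?GRing.addr0// => i /andP[i0 _].
  by rewrite gtn_eqF// GRing.mul0r.
have z0 : z != 0%R.
  by apply: contraTneq (ug_neq0 v) => z0;
    rewrite -zE z0 GRing.expr0n gtn_eqF ?eqxx.
by exists (to_unit z0); apply: val_inj; rewrite ugX.
Qed.

(** For n > 1 some n-th root is different from 1; when v = 1 it is found as a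
    root of 1 + X + ... + X^(n-1), whose value n at 1 is nonzero. *)
Lemma unit_root_neq1 n (v : U) : (1 < n)%N ->
  exists2 z : U, z ^+ n = v & z != 1.
Proof.
move=> n1; have [->|v1] := eqVneq v 1; last first.
  have [z zv] := unit_root v (ltnW n1); exists z => //.
  by apply: contraNneq v1 => z1; rewrite -zv z1 expg1n.
case: n n1 => // n; rewrite ltnS => n0.
have [z zE] := GRing.solve_monicpoly n (fun=> (-1)%R : K) n0.
have {}zE : (\sum_(i < n.+1) z ^+ i = 0 :> K)%R.
  rewrite big_ord_recr /= zE -big_split big1//= => i _.
  by rewrite GRing.mulN1r GRing.subrr.
have zn : (z ^+ n.+1 = 1)%R.
  by apply/eqP; rewrite -GRing.subr_eq0 GRing.subrX1 zE GRing.mulr0.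
have z0 : z != 0%R.
  by apply/eqP => z0; move: zn; rewrite z0 GRing.expr0n => /eqP;
    rewrite eq_sym GRing.oner_eq0.
exists (to_unit z0); first by apply: val_inj; rewrite ugX.
apply/eqP => /(congr1 val) /= z1; move: zE; rewrite z1.
under eq_bigr do rewrite GRing.expr1n.
by rewrite GRing.sumr_const card_ord => /eqP; rewrite Num.Theory.pnatr_eq0.
Qed.

(** A finite group D, given by a duplicate-free list s of its elements, has
    at most |D| characters: by orthogonality, the character matrix X
    satisfies X *m Y = |D| *: 1 for the matrix Y of inverse values, so its
    rank is the number of rows. *)
Lemma card_hom_le (D : groupType) (s : seq D) (n : nat) (chi : 'I_n ->
  ghom D U) :
  uniq s -> (forall d, d \in s) ->
  (forall i i', i != i' -> exists d, chi i d != chi i' d) -> (n <= size s)%N.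
Proof.
move=> s_uniq sT chi_neq.
pose m := size s; pose X : 'M[K]_(n, m) := (\matrix_(i,
  j) val (chi i (nth 1%g s j)))%R.
pose Y : 'M[K]_(m, n) := (\matrix_(j, i) val (chi i (nth 1%g s j))^-1%g)%R.
have shift d0 : perm_eq [seq d0 * d | d <- s] s.
  apply: uniq_perm => //; first by rewrite map_inj_uniq//; exact: mulgI.
  by move=> d; rewrite sT; apply/mapP; exists (d0^-1 * d); rewrite ?mulKVg.
have XY : (X *m Y = m%:R *: 1%:M)%R.
  apply/matrixP => i i'; rewrite !mxE.
  under eq_bigr do rewrite !mxE.
  rewrite -(big_mkord xpredT (fun j =>
    val (chi i (nth 1%g s j)) * val (chi i' (nth 1%g s j))^-1%g)%R).
  rewrite -(big_nth 1 xpredT (fun d => val (chi i d) * val (chi i' d)^-1%g)%R).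
  have [<-|ii'] := eqVneq i i'.
    under eq_bigr do rewrite -ugM mulgV.
    by rewrite big_const_seq count_predT iter_addr_0 GRing.mulr1.
  (* Translating by d0 multiplies the sum by a factor other than 1. *)
  rewrite GRing.mulr0; have [d0 d0_neq] := chi_neq _ _ ii'.
  set S := (\sum_(d <- s) _)%R.
  have : (val (chi i d0 * (chi i' d0)^-1)%g * S = S)%R.
    rewrite /S GRing.mulr_sumr -[RHS](perm_big _ (shift d0)) big_map.
    apply: eq_bigr => d _; rewrite -!ugM; congr val.
    by rewrite !gmulfM invgM (ugC (chi i' d)^-1) (abel_mulACA ugC).
  move/eqP; rewrite -[X in _ == X]GRing.mul1r -GRing.subr_eq0 -GRing.mulrBl
    GRing.mulf_eq0.
  case/orP => [|/eqP//]; rewrite GRing.subr_eq0 -ug1 (inj_eq val_inj).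
  by rewrite divg_eq1 (negPf d0_neq).
have [m0|m0] := posnP m; first by have := sT 1; rewrite (size0nil m0).
rewrite -(mxrank1 K n) -(mxrank_scale_nz 1%:M (_ : m%:R != 0)%R); last first.
  by rewrite Num.Theory.pnatr_eq0 -lt0n.
by rewrite -XY; exact: mulmx_max_rank.
Qed.

End ScalarUnits.

Section Separation.
Variables (K : numClosedFieldType) (A : groupType).
Hypothesis mulAC : forall x y : A, x * y = y * x.
Local Notation U := (unit_group K).
Implicit Types (D : set (A * U)) (a x y : A) (z w : U).

(** The graph of a partial character: closed under division and single-valued
    at 1, hence everywhere.  The empty graph is allowed, so that unions of
    arbitrary chains are graphs. *)
Definition partial_char D : Prop :=
  (forall x y z w, D (x, z) -> D (y, w) -> D (x / y, z / w)) /\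
  (forall z, D (1, z) -> z = 1).

(** A partial character extends to a further element a, with a value other
    than 1: if a^m is the first positive power in the domain, an m-th root of
    its value is chosen; if there is none, any value will do, and -1 is
    chosen. *)
Lemma partial_char_extend D a : partial_char D -> D (1, 1) ->
  (forall z, ~ D (a, z)) ->
  exists (D' : set (A * U)) z, [/\ partial_char D', D `<=` D', D' (a,
    z) & z != 1].
Proof.
move=> [Ddiv D1] D11 aD.
have DV x z : D (x, z) -> D (x^-1, z^-1).
  by move=> xz; have := Ddiv _ _ _ _ D11 xz; rewrite !div1g.
have DM x y z w : D (x, z) -> D (y, w) -> D (x * y, z * w).
  by move=> xz yw; have := Ddiv _ _ _ _ xz (DV _ _ yw); rewrite !invgK.
have DX x z n : D (x, z) -> D (x ^+ n, z ^+ n).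
  by move=> xz; elim: n => [|n IH]; rewrite ?expg0// !expgS; exact: DM.
have [z zD z1] : exists2 z, (forall n w, D (a ^+ n, w) -> z ^+ n = w) & z != 1.
  pose Q n := `[< (0 < n)%N /\ exists w, D (a ^+ n, w) >].
  have [exQ|noQ] := pselect (exists n, Q n); last first.
    have N10 : (- 1 != 0 :> K)%R by rewrite GRing.oppr_eq0 GRing.oner_eq0.
    exists (to_unit N10).
      move=> [|n] w nw; first by rewrite expg0 (D1 _ nw).
      by case: noQ; exists n.+1; apply/asboolP; split=> //; exists w.
    apply/eqP => /(congr1 val)/eqP /=.
    by rewrite -GRing.subr_eq0 -GRing.opprD GRing.oppr_eq0
      (Num.Theory.pnatr_eq0 _ 2).
  case: (ex_minnP exQ) => m /asboolP[m0 [v mv]] min_m.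
  have m1 : (1 < m)%N.
    by case: m m0 mv {min_m} => [|[|m]]// _; rewrite expg1 => /aD.
  have [z zm z1] := unit_root_neq1 v m1; exists z => // n w nw.
  have mod0 : (n %% m)%N = 0%N.
    apply: contraTeq isT; rewrite -lt0n => r0.
    have : Q (n %% m)%N.
      apply/asboolP; split=> //; exists (w / v ^+ (n %/ m)).
      have -> : a ^+ (n %% m) = a ^+ n / (a ^+ m) ^+ (n %/ m).
        rewrite {2}(divn_eq n m) expgnDr mulnC expgnA mulAC mulgA.
        by rewrite mulVg mul1g.
      exact/Ddiv/DX.
    by move=> /min_m; rewrite leqNgt ltn_mod m0.
  have nE : n = (m * (n %/ m))%N by rewrite {1}(divn_eq n m) mod0 addn0 mulnC.
  move: (n %/ m)%N nE => k nE; rewrite {}nE in nw *.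
  rewrite expgnA zm; apply/esym/divg1_eq/D1; rewrite -(divgg (a ^+ (m * k))).
  by apply: Ddiv => //; rewrite expgnA; exact: DX.
pose D' : set (A * U) := [set u | exists i j y w, D (y, w) /\
   u = (a ^+ i / a ^+ j * y, z ^+ i / z ^+ j * w)].
exists D', z; split=> //; last first.
- exists 1%N, 0%N, 1, 1; split=> //.
  by rewrite !expg0 !expg1 !divg1 !mulg1.
- move=> [y w] yw; exists 0%N, 0%N, y, w; split=> //.
  by rewrite !expg0 !divg1 !mul1g.
split=> [x y u w [i [j [x' [u' [xu' [-> ->]]]]]] [k [l [y' [w' [yw' [->
  ->]]]]]]|].
  exists (i + l)%N, (j + k)%N, (x' / y'), (u' / w'); split; first exact: Ddiv.
  have ac (B : groupType) (BC : forall x y : B, x * y = y * x) (b x0 y0 : B) :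
      b ^+ i / b ^+ j * x0 / (b ^+ k / b ^+ l * y0) =
      b ^+ (i + l) / b ^+ (j + k) * (x0 / y0).
    rewrite !expgnDr !invgM invgK (BC y0^-1) (abel_mulACA BC); congr (_ * _).
    by rewrite (abel_mulACA BC) (BC (b ^+ j)^-1).
  by rewrite !ac//; exact: ugC.
move=> u [i [j [y [w [yw [yE ->]]]]]].
have [ij|/ltnW ij] := leqP j i.
  have E (B : groupType) (b : B) : b ^+ i / b ^+ j = b ^+ (i - j).
    by rewrite -{1}(subnK ij) expgnDr mulgK.
  rewrite !E in yE *; have yE' : a ^+ (i - j) = y^-1.
    by apply/eqP; rewrite -mulg_eq1 -yE.
  by rewrite (zD _ w^-1) ?mulVg// yE'; exact: DV.
have E (B : groupType) (b : B) : b ^+ i / b ^+ j = (b ^+ (j - i))^-1.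
  by rewrite -{1}(subnK ij) expgnDr invgM mulgA mulgV mul1g.
rewrite !E in yE *; have yE' : a ^+ (j - i) = y.
  by have /mulg1_eq := esym yE; rewrite invgK.
by rewrite (zD _ w) ?mulVg// yE'.
Qed.

(** The characters of an abelian group separate its points. *)
Lemma hom_separates (b : A) : b != 1 -> exists chi : ghom A U, chi b != 1.
Proof.
(* A maximal graph among those that do not send b to 1 is total: it contains
   b, since b could be adjoined with a value other than 1, and then any
   extension still avoids (b, 1). *)
move=> b1; pose P D := partial_char D /\ ~ D (b, 1).
have [D [[Dp Db] Dmax]] : exists D, P D /\ forall D', D `<` D' -> ~ P D'.
  apply: Zorn_bigcup => F FP Ftot; split; last by case=> D /FP[_ Db] /Db.
  split=> [x y z w [D1 FD1 xz] [D2 FD2 yw]|z [D /FP[[_ D1] _]]]; last exact: D1.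
  have [D12|D21] := Ftot _ _ FD1 FD2.
    by exists D2 => //; apply: (FP _ FD2).1.1 => //; exact: D12.
  by exists D1 => //; apply: (FP _ FD1).1.1 => //; exact: D21.
have maxE D' : partial_char D' -> ~ D' (b, 1) -> D `<=` D' -> D' `<=` D.
  move=> D'p D'b DD'; apply: contrapT => nD'; exact: (Dmax D').
have D11 : D (1, 1).
  suff : [set (1, 1)] `<=` D by apply.
  have [D0|[[x z] xz]] : D = set0 \/ exists u, D u.
    by have [->|/set0P[u Du]] := eqVneq D set0; [left|right; exists u].
    apply: maxE; last by rewrite D0.
    - split=> [x y z w [-> ->] [-> ->]|z [->]]; last by [].
      by rewrite /= !divgg.
    - by move=> [] /eqP; rewrite (negPf b1).
  by move=> _ ->; have := Dp.1 _ _ _ _ xz xz; rewrite !divgg.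
have total a : exists z, D (a, z).
  have [[v Dbv]|noDb] := pselect (exists v, D (b, v)).
    apply: contrapT => noDa.
    have [|D' [z [D'p DD' D'a _]]] := @partial_char_extend D a Dp D11.
      by move=> z Dz; apply: noDa; exists z.
    apply: noDa; exists z; apply: maxE D'a => // D'b.
    have := D'p.1 _ _ _ _ (DD' _ Dbv) D'b; rewrite divgg => /D'p.2.
    by rewrite divg1 => v1; apply: Db; rewrite -v1.
  have [|D' [z [D'p DD' D'b z1]]] := @partial_char_extend D b Dp D11.
    by move=> z Dz; apply: noDb; exists z.
  case: noDb; exists z; apply: (maxE D') (D'b) => // D'b1.
  have := D'p.1 _ _ _ _ D'b D'b1; rewrite divgg => /D'p.2 /eqP.
  by rewrite divg1 (negPf z1).
have Dfun a z w : D (a, z) -> D (a, w) -> z = w.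
  by move=> az aw; apply/divg1_eq/Dp.2; rewrite -(divgg a); exact: Dp.1.
pose chi0 a := projT1 (cid (total a)).
have chi0D a : D (a, chi0 a) by exact: projT2 (cid (total a)).
have chi0M : {morph chi0 : x y / x * y}.
  move=> x y; apply: (Dfun (x * y)) => //.
  have yV : D (y^-1, (chi0 y)^-1).
    by rewrite -div1g -[_^-1 in X in D (_, X)]div1g; exact: Dp.1.
  by rewrite -{1}(invgK y) -(invgK (chi0 y)); exact: Dp.1.
pose chiH := isUMagmaMorphism.Build _ _ chi0 (morph_hom chi0M).
exists (HB.pack chi0 chiH : ghom A U).
by apply/eqP => /= cb1; apply: Db; rewrite -cb1.
Qed.

End Separation.

(** * The Schur multiplier is finite *)

Section SchurMultiplierFinite.
Variables (R : realType) (G : finGroupType).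
Local Notation Cx := (unit_group R[i]).
Local Notation SM := (schur_multiplier R G).

Lemma cocycle2_ring (c : {ffun G * G -> Cx}) : c \in @cocycle2 R G ->
  forall x y z, (val (c (x, y)) * val (c ((x * y)%g, z)) =
                 val (c (y, z)) * val (c (x, (y * z)%g)))%R.
Proof. by move=> /cocycle2P cP x y z; have /(congr1 val) := cP x y z. Qed.

Lemma coboundary_cocycle (c : {ffun G * G -> Cx}) :
  coboundary2 c -> c \in @cocycle2 R G.
Proof.
move=> [t tE]; apply/cocycle2P => x y z; rewrite !tE [x * (y * z)]mulgA;
  apply: val_inj => /=.
by field; rewrite ?ug_neq0.
Qed.

Lemma unity_roots_finite n : (0 < n)%N ->
  exists s : seq Cx, forall z, z ^+ n = 1 -> z \in s.
Proof.
move=> n0; have [r rE] := closed_field_poly_normal ('X^n - 1 : {poly R[i]})%R.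
exists (pmap insub r) => z zn; rewrite mem_pmap_sub.
have : root ('X^n - 1 : {poly R[i]})%R (val z).
  by rewrite rootE !hornerE -ugX zn GRing.subrr.
by rewrite rE rootZ ?root_prod_XsubC// (eqP (monicXnsubC _ _)) ?GRing.oner_eq0.
Qed.

(** Every 2-cocycle is cohomologous to one with values in the roots of unity
    of order dividing |G|: if t x is the product of the c (x, z) over all z,
    then the |G|-th power of c is the coboundary of t, and one divides c by
    the coboundary of a |G|-th root of t. *)
Lemma cocycle_unity (c : {ffun G * G -> Cx}) : c \in @cocycle2 R G ->
  exists2 d, coboundary2 d & forall u, (c / d) u ^+ #|G| = 1.
Proof.
move=> cP; pose t x : R[i] := (\prod_z val (c (x, z)))%R.
have t0 x : t x != 0%R by apply/GRing.prodf_neq0 => z _; exact: ug_neq0.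
have tM x y : (val (c (x, y)) ^+ #|G| * t (x * y)%g = t x * t y)%R.
  rewrite /t [in RHS](reindex_inj (mulgI y)) /= -GRing.prodr_const -!big_split
    /=.
  by apply: eq_bigr => z _; rewrite cocycle2_ring// GRing.mulrC.
have n0 : (0 < #|G|)%N by apply/card_gt0P; exists 1.
have [s sE] := choice (fun x => unit_root (to_unit (t0 x)) n0).
exists [ffun u => s u.1 * s u.2 * (s (u.1 * u.2))^-1].
  by exists [ffun x => s x] => x y; rewrite !ffunE.
move=> [x y]; rewrite !ffunE /=; apply: val_inj; rewrite ugX /=.
have sX z : (val (s z) ^+ #|G|)%R = t z by rewrite -ugX sE.
rewrite !(GRing.exprMn, GRing.exprVn) !sX -tM.
by field; rewrite ?GRing.expf_neq0 ?ug_neq0 ?t0.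
Qed.

Lemma schur_multiplier_finite :
  exists s : seq SM, uniq s /\ forall u, u \in s.
Proof.
have n0 : (0 < #|G|)%N by apply/card_gt0P; exists 1.
have [rs rsP] := unity_roots_finite n0.
pose cls (f : {ffun G * G -> seq_sub rs}) : SM :=
  qmap _ (insubd 1 [ffun u => val (f u)]).
exists (undup [seq cls f | f <- enum {ffun G * G -> seq_sub rs}]).
split=> [|u]; first exact: undup_uniq.
rewrite mem_undup; case: (qmap_surj u) => c <- {u}; apply/mapP.
have [d dcob cd] := cocycle_unity (valP c).
pose d' : subgroup_type (@cocycle2 R G) := exist _ d (coboundary_cocycle dcob).
pose f := [ffun u => SeqSub (rsP _ (cd u))]; exists f;
  first by rewrite mem_enum.
have fE : [ffun u => val (f u)] = val (c / d').
  by apply/ffunP => u; rewrite !ffunE.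
rewrite /cls fE (_ : insubd 1 _ = c / d') ?qmapM; last first.
  by apply: val_inj; rewrite insubdK//; exact: (valP (c / d')).
have -> : qmap [set c | coboundary2 (val c)] d'^-1 = 1.
  apply/eqP; rewrite qmap_ker gpredV.
  exact: normal_closure_sub.
by rewrite mulg1.
Qed.

End SchurMultiplierFinite.

(** * Evaluation of the Schur multiplier at relators *)

(** The central extension of G by C^x defined by a cocycle c.  As c need not
    be normalised, its neutral element is (1, c (1, 1)^-1). *)
Definition cocycle_ext (R : realType) (G : finGroupType)
  (c : {ffun G * G -> unit_group R[i]}) of c \in @cocycle2 R G : Type :=
  (G * unit_group R[i])%type.

(** The pull-back of the cocycle c along p is the coboundary of t^-1. *)
Definition cocycle_lifting (R : realType) (G : finGroupType) (F : groupType)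
    (p : ghom F G) (c : {ffun G * G -> unit_group R[i]})
    (t : F -> unit_group R[i]) : Prop :=
  forall x y, t (x * y) = t x * t y * c (p x, p y).

Section CocycleExtension.
Variables (R : realType) (G : finGroupType).
Local Notation Cx := (unit_group R[i]).
Variables (c : {ffun G * G -> Cx}) (cP : c \in @cocycle2 R G).
Local Notation E := (cocycle_ext cP).

HB.instance Definition _ := Choice.on E.

Lemma cocycle1x x : c (1, x) = c (1, 1).
Proof.
have /cocycle2P/(_ 1 1 x) := cP; rewrite !mul1g.
by move/mulIg.
Qed.

Lemma cocyclex1 x : c (x, 1) = c (1, 1).
Proof.
have /cocycle2P/(_ x 1 1) := cP; rewrite !mulg1.
by move/mulIg.
Qed.

Lemma cocycleV x : c (x^-1, x) = c (x, x^-1).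
Proof.
have /cocycle2P/(_ x x^-1 x) := cP;
  rewrite mulgV mulVg (cocycle1x x) (cocyclex1 x).
by move/mulIg.
Qed.

Definition cext_mul (a b : E) : E := (a.1 * b.1, a.2 * b.2 * c (a.1, b.1)).
Definition cext_one : E := (1, (c (1, 1))^-1).
Definition cext_inv (a : E) : E :=
  (a.1^-1, a.2^-1 * (c (1, 1))^-1 * (c (a.1, a.1^-1))^-1).

Lemma cext_mulA : associative cext_mul.
Proof.
move=> [x u] [y v] [z w]; rewrite /cext_mul /= mulgA; congr (_, _).
have cE := cocycle2_ring cP x y z; apply: val_inj; rewrite !ugM.
transitivity (val u * val v * val w *
              (val (c (y, z)) * val (c (x, (y * z)%g))))%R; first by ring.
by rewrite -cE; ring.
Qed.
Lemma cext_mul1 : left_id cext_one cext_mul.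
Proof.
move=> [x u]; rewrite /cext_mul /= mul1g (cocycle1x x); congr (_, _).
by rewrite (ugC _ u) mulgVK.
Qed.
Lemma cext_mulr1 : right_id cext_one cext_mul.
Proof. by move=> [x u]; rewrite /cext_mul /= mulg1 (cocyclex1 x) mulgVK. Qed.
Lemma cext_mulV : left_inverse cext_one cext_inv cext_mul.
Proof.
move=> [x u]; rewrite /cext_mul /= mulVg cocycleV; congr (_, _).
apply: val_inj => /=; field; rewrite ?ug_neq0//.
Qed.
Lemma cext_mulVr : right_inverse cext_one cext_inv cext_mul.
Proof.
move=> [x u]; rewrite /cext_mul /= mulgV; congr (_, _).
apply: val_inj => /=; field; rewrite ?ug_neq0//.
Qed.
HB.instance Definition _ := isGroup.Build E
  cext_mulA cext_mul1 cext_mulr1 cext_mulV cext_mulVr.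

(** On a free group, every cocycle c becomes a coboundary, because the map to
    G lifts to the extension defined by c. *)
Lemma cocycle_lift (A : choiceType) (p : ghom (free_group A) G) :
  exists t : free_group A -> Cx, cocycle_lifting p c t.
Proof.
pose e : ghom (free_group A) E := free_lift (fun a => (p (fgen a), 1) : E).
pose pr (a : E) : G := a.1.
have prM : {morph pr : a b / a * b} by [].
pose prH := isUMagmaMorphism.Build _ _ pr (morph_hom prM).
pose pr' : ghom E G := HB.pack pr prH.
have pE x : (e x).1 = p x.
  apply: (@free_ext _ _ (pr' \o e : ghom _ _) p) => a /=.
  by rewrite /pr /= free_liftE.
exists (fun x => (e x).2) => x y.
by rewrite gmulfM -!pE.
Qed.

(** Two solutions differ by a morphism to an abelian group, hence agree on
    the commutator subgroup. *)
Lemma cocycle_lift_uniq (F : groupType) (p : ghom F G) (t t' : F -> Cx) :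
  cocycle_lifting p c t -> cocycle_lifting p c t' ->
  forall x, x \in derived (full F) -> t x = t' x.
Proof.
move=> tM t'M.
pose f x := t x / t' x.
have fM : {morph f : x y / x * y}.
  move=> x y; rewrite /f tM t'M; apply: val_inj => /=.
  by field; rewrite ?ug_neq0.
pose fH := isUMagmaMorphism.Build _ _ f (morph_hom fM).
pose f' : ghom F Cx := HB.pack f fH.
have f1 : f' 1 = 1 by rewrite gmulf1.
have fV y : f' y^-1 = (f' y)^-1 by rewrite gmulfV.
have fR y z : f' [~ y, z] = 1.
  by rewrite gmulfR; apply/eqP/commgP; exact: ugC.
move=> x xF; apply/divg1_eq;
  apply: (gen_rec (P := [set x | f x = 1])) xF => //=.
- by move=> y z; rewrite fM => -> ->; rewrite mulg1.
- by move=> y y1; rewrite [LHS]fV -[RHS]invg1; congr (_^-1).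
- by move=> _ [y [z [_ _ ->]]]; exact: fR.
Qed.

End CocycleExtension.

(** The subgroup [N, F], where N is the kernel of p. *)
Definition commNF (F G : groupType) (p : ghom F G) : {pred F} :=
  gen [set z | exists n x, p n = 1 /\ z = [~ n, x]].
HB.instance Definition _ (F G : groupType) (p : ghom F G) :=
  GroupClosed.on (commNF p).

Lemma commNF_normal (F G : groupType) (p : ghom F G) :
  conj_stable [set` commNF p].
Proof.
move=> x y /= xN; apply: gen_conj xN => _ [n [z [pn ->]]]; apply: gen_sub.
by exists (n ^ y), (z ^ y); rewrite gmulfJ pn conj1g conjRg.
Qed.

Section Pairing.
Variables (R : realType) (G : finGroupType).
Local Notation Cx := (unit_group R[i]).
Local Notation SM := (schur_multiplier R G).

Lemma cocycle_lifting_mul (F : groupType) (p : ghom F G)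
    (c d : {ffun G * G -> Cx}) (t u : F -> Cx) :
  cocycle_lifting p c t -> cocycle_lifting p d u ->
  cocycle_lifting p (c * d) (fun x => t x * u x).
Proof.
move=> tM uM x y; rewrite tM uM ffunE.
by rewrite (abel_mulACA (@ugC _)) (abel_mulACA (@ugC _) (t x)).
Qed.

Lemma cocycle_lifting_coboundary (F : groupType) (p : ghom F G)
    (c : {ffun G * G -> Cx}) (s : G -> Cx) :
  (forall x y, c (x, y) = s x * s y * (s (x * y))^-1) ->
  cocycle_lifting p c (fun x => (s (p x))^-1).
Proof.
move=> sE x y; rewrite sE gmulfM; apply: val_inj => /=.
by field; rewrite ?ug_neq0.
Qed.

Section Surj.
Variables (F : groupType) (p : ghom F G).
Hypothesis p_surj : forall g, exists x, p x = g.

Lemma cocycle_lifting_cocycle (c : {ffun G * G -> Cx}) (t : F -> Cx) :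
  cocycle_lifting p c t -> c \in @cocycle2 R G.
Proof.
move=> tM; apply/cocycle2P => x' y' z'.
have [x <-] := p_surj x'; have [y <-] := p_surj y'; have [z <-] := p_surj z'.
have := tM (x * y) z; rewrite -mulgA tM (tM y z) (tM x y) !gmulfM => E.
exact: (@abel_cancel Cx (@ugC R[i]) _ _ _ _ _ _ _ E).
Qed.

(** A relator outside [N, F] is detected by some cocycle: take a character
    chi of N / [N, F] that is nontrivial at b, a section s of p, and the
    cocycle c (g, h) = chi (s (gh)^-1 s g s h), which is the one that the
    extension F / [N, F] of G and chi define. *)
Lemma cocycle_separates b : p b = 1 -> b \notin commNF p ->
  exists (c : {ffun G * G -> Cx}) (t : F -> Cx),
    cocycle_lifting p c t /\ t b * c (1, 1) != 1.
Proof.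
move=> pb bN; pose N := subgroup_type (ker p).
pose S : set N := [set x | val x \in commNF p].
have S_nc x : x \in normal_closure S -> S x.
  apply: (normal_closure_rec (P := S)) => [|y z|y|y z|y //]; rewrite /S /=.
  - exact: gpred1.
  - exact: gpredM.
  - exact: gpredVr.
  - by move=> yN; exact: (@commNF_normal _ _ p _ (val z) yN).
(* The class of x in N / [N, F], with the junk value 1 when x is not in N. *)
pose q x := qmap S (insubd 1 x).
have valN x : p x = 1 -> val (insubd (1 : N) x) = x.
  by move=> px; rewrite insubdK//; apply/eqP.
have qM x y : p x = 1 -> p y = 1 -> q (x * y) = q x * q y.
  move=> px py; rewrite -qmapM; congr (qmap S _); apply: val_inj.
  by rewrite /= !valN// gmulfM px py mulg1.
have qJ x z : p x = 1 -> q (x ^ z) = q x.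
  move=> px; have pxz : p [~ x, z] = 1 by rewrite gmulfR px comm1g.
  have -> : x ^ z = x * [~ x, z] by rewrite commgEl mulKVg.
  rewrite qM// [X in _ * X](_ : _ = 1) ?mulg1//.
  apply/eqP; rewrite qmap_ker; apply: normal_closure_sub.
  by rewrite /S /= valN//; apply: gen_sub; exists x, z.
have mulC (x y : quot S) : x * y = y * x.
  case: (qmap_surj x) (qmap_surj y) => u <- [v <-].
  have qE (w : N) : qmap S w = q (val w).
    by rewrite /q; congr (qmap S _); rewrite valKd.
  have pN (w : N) : p (val w) = 1 by apply/eqP; exact: (valP w).
  rewrite !qE -!qM// [val u * _]conjgC [LHS]qM//;
    last by rewrite gmulfJ pN conj1g.
  by rewrite qJ// qM.
have [|chi chib] := hom_separates R[i] mulC (b := q b).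
  by rewrite qmap_ker; apply: contra bN => /S_nc; rewrite /S /= valN.
have chiM u v : chi (u * v) = chi u * chi v by rewrite gmulfM.
have [s sK] := choice p_surj.
pose t x := chi (q ((s (p x))^-1 * x)).
pose c : {ffun G * G -> Cx} := [ffun u =>
  chi (q ((s (u.1 * u.2))^-1 * (s u.1 * s u.2)))].
exists c, t; split=> [x y|].
  have p1 z : p ((s (p z))^-1 * z) = 1 by rewrite gmulfM gmulfV sK mulVg.
  have p2 : p ((s (p x * p y))^-1 * (s (p x) * s (p y))) = 1.
    by rewrite !gmulfM gmulfV !sK mulVg.
  rewrite /c ffunE /t /= -!chiM [p (x * y)]gmulfM; congr (chi _).
  have p3 : p (((s (p x))^-1 * x) ^ s (p y)) = 1 by rewrite gmulfJ p1 conj1g.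
  rewrite [RHS]mulC [RHS]mulgA -(qJ _ (s (p y)) (p1 x)) -(qM _ _ p2 p3) -qM//;
    last first.
    by rewrite gmulfM p2 p3 mulg1.
  congr q; rewrite /conjg !mulgA.
  by rewrite !mulgK.
have s1 : p (s 1) = 1 by exact: sK.
have s1V : p (s 1)^-1 = 1 by rewrite gmulfV s1 invg1.
rewrite /t /c ffunE /= pb mulg1 mulKg -chiM !qM//.
have q1 : q 1 = 1.
  by apply: (mulgI (q 1)); rewrite -qM ?gmulf1// !mulg1.
by rewrite mulC -mulgA -qM// mulVg q1 mulg1.
Qed.

End Surj.

Section FreeSource.
Variables (A : choiceType) (p : ghom (free_group A) G).
Local Notation F := (free_group A).

(** Evaluation of multiplier classes at a relator b in F'.  The factor c (1,
    1) makes the value trivial on coboundaries. *)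
Lemma schur_eval b : p b = 1 -> b \in derived (full F) ->
  exists e : ghom SM Cx, forall (c : subgroup_type (@cocycle2 R G)) t,
    cocycle_lifting p (val c) t ->
    e (qmap [set x | coboundary2 (val x)] c) = t b * val c (1, 1).
Proof.
move=> pb bF.
have [th thM] := choice (fun c : subgroup_type (@cocycle2 R G) =>
  cocycle_lift (valP c) p).
pose e0 (c : subgroup_type (@cocycle2 R G)) := th c b * val c (1, 1).
have e0M : {morph e0 : c d / c * d}.
  move=> c d; rewrite /e0 [val (c * d)](_ : _ = val c * val d)// ffunE.
  have cdM := cocycle_lifting_mul (thM c) (thM d).
  by rewrite (cocycle_lift_uniq (thM (c * d)) cdM bF) (abel_mulACA (@ugC _)).
pose eH := isUMagmaMorphism.Build _ _ e0 (morph_hom e0M).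
pose e1 : ghom (subgroup_type (@cocycle2 R G)) Cx := HB.pack e0 eH.
have [|e eE] := @quot_lift _ _ [set c | coboundary2 (val c)] e1.
  move=> c /= [t tE]; rewrite inE; apply/eqP; rewrite /= /e0.
  rewrite (cocycle_lift_uniq (thM c) (cocycle_lifting_coboundary p tE) bF).
  by rewrite tE pb !mulg1 mulgK mulVg.
exists e => c t tM; rewrite eE /= /e0.
by rewrite (cocycle_lift_uniq (thM c) tM bF).
Qed.

(** The number of classes of N \cap F' modulo [N, F] is at most the order of
    the Schur multiplier. *)
Lemma schur_bound (p_surj : forall g, exists x, p x = g) (s : seq SM)
    (n : nat) (f : 'I_n -> F) :
  uniq s -> (forall u, u \in s) ->
  (forall i, p (f i) = 1 /\ f i \in derived (full F)) ->
  (forall i j, i != j -> f i / f j \notin commNF p) -> (n <= size s)%N.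
Proof.
move=> s_uniq sT fN f_neq.
have [e eE] := choice (fun i => schur_eval (fN i).1 (fN i).2).
apply: (@card_hom_le _ _ s n e) => // i j ij.
have pij : p (f i / f j) = 1 by rewrite gmulfF !(fN _).1 divgg.
have [c [t [tM tb]]] := cocycle_separates p_surj pij (f_neq _ _ ij).
have cP := cocycle_lifting_cocycle p_surj tM.
pose c' : subgroup_type (@cocycle2 R G) := exist _ c cP.
exists (qmap _ c'); rewrite !(eE _ c' t tM) /=.
apply: contra tb => /eqP/mulIg tij.
have := tM (f i / f j) (f j); rewrite mulgVK tij pij (fN j).1.
rewrite -mulgA (ugC (t (f j))) mulgA => E.
by apply/eqP/(mulIg (t (f j))); rewrite mul1g.
Qed.

(** If phi maps N \cap F' onto a group M isomorphic to the Schur multiplier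
    and kills [N, F], then its kernel on N \cap F' is exactly [N, F]. *)
Lemma schur_cover_lift_inj (p_surj : forall g, exists x, p x = g)
    (H : groupType) (M : groupClosed H) (phi : ghom F H) :
  isomorphic (subgroup_type M) SM ->
  (forall m, m \in M -> exists x, [/\ p x = 1,
    x \in derived (full F) & phi x = m]) ->
  (forall x, x \in commNF p -> phi x = 1) ->
  forall x, p x = 1 -> x \in derived (full F) -> phi x = 1 -> x \in commNF p.
Proof.
move=> [h [h' hK h'K]] phiM phi1 x px xF phix; apply: contrapT => /negP xN.
have [s [s_uniq sT]] := schur_multiplier_finite R G.
have [l lP] := choice (fun u : SM => phiM (val (h' u)) (valP (h' u))).
(* If x is not in [N, F], then lifts of the elements of M, together with the
   product of x and the lift of 1, are |M| + 1 distinct classes. *)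
pose f (i : 'I_(size s).+1) : F :=
  if unlift ord0 i is Some k then l (nth 1 s k) else l (h 1) * x.
suff : ((size s).+1 <= size s)%N by rewrite ltnn.
have lF u : p (l u) = 1 /\ l u \in derived (full F) by have [] := lP u.
have phil u : phi (l u) = val (h' u) by have [] := lP u.
apply: (@schur_bound p_surj s _ f) => // [i|i j].
  rewrite /f; case: (unlift _ _) => [k|]; first exact: lF.
  by rewrite gmulfM px mulg1 (lF _).1 gpredM// (lF _).2.
have key (k : 'I_(size s)) : l (nth 1 s k) / (l (h 1) * x) \notin commNF p.
  apply/negP => kN; have := phi1 _ kN; rewrite gmulfF gmulfM phix mulg1 !phil.
  move/divg1_eq/val_inj/(can_inj h'K) => k1.
  apply: (negP xN); rewrite -gpredV -(conjgKV (l (h 1)) x^-1).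
  apply: (@commNF_normal _ _ p _ (l (h 1))).
  by move: kN; rewrite k1 conjgE invgK invgM.
rewrite /f; case: (unliftP ord0 i) => [k ->|->];
  case: (unliftP ord0 j) => [k' ->|->].
- rewrite (inj_eq lift_inj) => kk'; apply/negP => /phi1.
  rewrite gmulfF !phil => /divg1_eq/val_inj/(can_inj h'K)/eqP.
  by rewrite nth_uniq// (inj_eq val_inj) (negPf kk').
- by move=> _; exact: key.
- by move=> _; rewrite -gpredV invgF; exact: key.
- by rewrite eqxx.
Qed.

End FreeSource.
End Pairing.

(** * Quotients, commutator subgroups and triples *)

Lemma bijective_inj_surj (A B : Type) (f : A -> B) :
  injective f -> (forall b, exists a, f a = b) -> bijective f.
Proof.
move=> f_inj f_surj; have [g gK] := choice f_surj.
by exists g => // a; apply: f_inj; rewrite gK.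
Qed.

Lemma quot_isomorphic (G T : groupType) (S : set G) (f : ghom G T) :
  (forall y, exists x, f x = y) -> (forall x, S x <-> f x = 1) ->
  isomorphic (quot S) T.
Proof.
move=> f_surj fS; have [|g gE] := @quot_lift _ _ S f.
  by move=> x /fS fx; apply/eqP.
exists g; apply: bijective_inj_surj => [|y]; last first.
  by have [x <-] := f_surj y; exists (qmap S x); rewrite gE.
apply: gmulf_inj => a; case: (qmap_surj a) => x <- {a}.
by rewrite gE => /fS Sx; apply/eqP; rewrite qmap_ker normal_closure_sub.
Qed.

Section Derived.
Implicit Types G H : groupType.

Lemma derived_comm G (x y : G) : [~ x, y] \in derived (full G).
Proof. by apply: gen_sub; exists x, y. Qed.

Lemma derived_morph G H (f : ghom G H) x :
  x \in derived (full G) -> f x \in derived (full H).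
Proof.
apply: (gen_rec (P := [set x | f x \in derived (full H)])) =>
  [|y z|y|_ [y [z [_ _ ->]]]] /=.
- by rewrite gmulf1 gpred1.
- by rewrite gmulfM; exact: gpredM.
- by rewrite gmulfV gpredV.
- by rewrite gmulfR; exact: derived_comm.
Qed.

Lemma derived_lift G H (f : ghom G H) (f_surj : forall y, exists x, f x = y) y :
  y \in derived (full H) -> exists2 x, x \in derived (full G) & f x = y.
Proof.
apply: (gen_rec (P := [set y | exists2 x, x \in derived (full G) & f x = y])) =>
  [|_ _ [u uG <-] [v vG <-]|_ [u uG <-]|_ [y' [z' [_ _ ->]]]] /=.
- by exists 1; rewrite ?gmulf1 ?gpred1.
- by exists (u * v); rewrite ?gmulfM ?gpredM.
- by exists u^-1; rewrite ?gmulfV ?gpredV.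
- have [u <-] := f_surj y'; have [v <-] := f_surj z'.
  by exists [~ u, v]; rewrite ?gmulfR ?derived_comm.
Qed.

Lemma prodV_rev_ord G l (E : 'I_l -> G) :
  \prod_(i < l) (E i)^-1 = (\prod_(i < l) E (rev_ord i))^-1.
Proof.
elim: l E => [|l IH] E; first by rewrite !big_ord0 invg1.
rewrite big_ord_recr big_ord_recl /= invgM IH; congr (_^-1 * (E _)^-1).
  by apply: eq_bigr => i _; congr (E _); apply: val_inj;
    rewrite /= /bump /= add1n subSS.
by apply: val_inj; rewrite /= subSS subn0.
Qed.

Lemma derived_prod G (x : G) : x \in derived (full G) ->
  exists l (h k : 'I_l -> G), x = \prod_(i < l) [~ h (rev_ord i),
    k (rev_ord i)].
Proof.
pose P := [set x : G | exists s : seq (G * G), x = \prod_(u <- s) [~ u.1, u.2]].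
move=> xG; suff [s ->] : P x.
  exists (size s), (fun i => (nth (1, 1) s (rev_ord i)).1),
    (fun i => (nth (1, 1) s (rev_ord i)).2).
  rewrite (big_nth (1, 1)) big_mkord; apply: eq_bigr => i _.
  by rewrite !rev_ordK.
apply: (gen_rec (P := P)) xG =>
  [|_ _ [s ->] [t ->]|_ [s ->]|_ [y [z [_ _ ->]]]].
- by exists [::]; rewrite big_nil.
- by exists (s ++ t); rewrite big_cat.
- exists (rev [seq (u.2, u.1) | u <- s]).
  elim: s => [|u s IH]; first by rewrite !big_nil invg1.
  by rewrite big_cons invgM IH /= rev_cons -cats1 big_cat big_seq1 invgR.
- by exists [:: (y, z)]; rewrite big_seq1.
Qed.

End Derived.

Section Triples.
Variable X : groupType.
Implicit Types a b c : X.

(** The three positions of a triple, in the form in which big_ord_recl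
    produces them. *)
Definition pos0 : 'I_3 := ord0.
Definition pos1 : 'I_3 := lift ord0 ord0.
Definition pos2 : 'I_3 := lift ord0 (lift ord0 ord0).

(** The triple (a, b, c) as an element of X^3. *)
Definition mk3 a b c : {ffun 'I_3 -> X} :=
  [ffun i : 'I_3 => match val i with 0%N => a | 1%N => b | _ => c end].

Lemma mk3E a b c :
  (mk3 a b c pos0 = a) * (mk3 a b c pos1 = b) * (mk3 a b c pos2 = c).
Proof. by rewrite !ffunE. Qed.

Lemma mk3_eta (g : {ffun 'I_3 -> X}) : g = mk3 (g pos0) (g pos1) (g pos2).
Proof.
apply/ffunP => i; rewrite ffunE; case: i => [[|[|[|//]]] i3] /=;
  by congr (g _); apply: val_inj.
Qed.

Lemma mk3_inj a b c a' b' c' : mk3 a b c = mk3 a' b' c' ->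
  [/\ a = a', b = b' & c = c'].
Proof.
move=> E; split.
- by rewrite -[LHS](mk3E a b c).1.1 E mk3E.
- by rewrite -[LHS](mk3E a b c).1.2 E mk3E.
- by rewrite -[LHS](mk3E a b c).2 E mk3E.
Qed.

Lemma mk3M a b c a' b' c' :
  mk3 a b c * mk3 a' b' c' = mk3 (a * a') (b * b') (c * c').
Proof. by apply/ffunP => i; rewrite !ffunE; case: (val i) => [|[|]]. Qed.

Lemma mk31 : mk3 1 1 1 = 1.
Proof. by apply/ffunP => i; rewrite !ffunE; case: (val i) => [|[|]]. Qed.

Lemma mk3V a b c : (mk3 a b c)^-1 = mk3 a^-1 b^-1 c^-1.
Proof. by apply: mulg1_eq; rewrite mk3M !mulgV mk31. Qed.

Lemma mk3J a b c a' b' c' :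
  mk3 a b c ^ mk3 a' b' c' = mk3 (a ^ a') (b ^ b') (c ^ c').
Proof. by rewrite /conjg mk3V !mk3M. Qed.

Lemma mk3R a b c a' b' c' :
  [~ mk3 a b c, mk3 a' b' c'] = mk3 [~ a, a'] [~ b, b'] [~ c, c'].
Proof. by rewrite /commg mk3J mk3V mk3M. Qed.

Lemma prod3 (g : 'I_3 -> X) : \prod_(i < 3) g i = g pos0 * (g pos1 * g pos2).
Proof. by rewrite !big_ord_recl big_ord0 mulg1. Qed.

Lemma mk3_Kset (K : {pred X}) a b c : mk3 a b c \in Kset 3 K ->
  [/\ a \in K, b \in K, c \in K & a * (b * c) \in derived K].
Proof.
case/andP => /forallP gK; rewrite prod3 !mk3E => gD; split=> //.
- by have := gK pos0; rewrite mk3E.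
- by have := gK pos1; rewrite mk3E.
- by have := gK pos2; rewrite mk3E.
Qed.

Lemma mk3_KsetP (K : {pred X}) a b c :
  a \in K -> b \in K -> c \in K -> a * (b * c) \in derived K ->
  mk3 a b c \in Kset 3 K.
Proof.
move=> aK bK cK abc; apply/andP; split; last by rewrite prod3 !mk3E.
by apply/forallP => i; rewrite ffunE; case: (val i) => [|[|]].
Qed.

End Triples.

(** * The Schur cover as a quotient of the free group *)

Lemma central_normal (H : groupType) (M : groupClosed H) :
  {subset M <= center H} -> conj_stable [set` M].
Proof.
move=> MZ x y /= xM; have /asboolP/(_ y) xy := MZ _ xM.
by rewrite conjgE xy mulKg.
Qed.

(** The map p lifts to the Schur cover H.  The lift is surjective: H is the
    product of its image and the central subgroup M, so H', and hence M, is
    contained in the image. *)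
Lemma schur_cover_lift (R : realType) (G : finGroupType) (H : groupType)
    (M : groupClosed H) (HM : schur_cover R G M) (A : choiceType)
    (p : ghom (free_group A) G) (p_surj : forall g, exists x, p x = g) :
  exists phi : ghom (free_group A) H,
    (forall x, (phi x \in M) = (p x == 1)) /\ forall h, exists x, phi x = h.
Proof.
have [[b [b' bK b'K]] MD MZ _] := HM.
pose pi : ghom H G := b \o qmap [set` M].
have piE h : pi h = b (qmap [set` M] h) by [].
have pi_surj g : exists h, pi h = g.
  by have [h hE] := qmap_surj (b' g); exists h; rewrite piE hE.
have pi_ker h : (pi h == 1) = (h \in M).
  rewrite piE gmulf_eq1 ?qmap_ker; last exact: can_inj bK.
  by rewrite normal_closure_id//; exact: central_normal.
have [e eE] := choice (fun a : A => pi_surj (p (fgen a))).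
pose phi : ghom (free_group A) H := free_lift e.
have phiE x : pi (phi x) = p x.
  apply: (@free_ext _ _ (pi \o phi : ghom _ _) p) => a.
  by rewrite -eE /= free_liftE.
exists phi; split=> [x|h]; first by rewrite -pi_ker phiE.
have dec h' : exists x m, [/\ m \in M & h' = phi x * m].
  have [x px] := p_surj (pi h'); exists x, ((phi x)^-1 * h').
  by rewrite mulKVg -pi_ker gmulfM gmulfV phiE px mulVg.
have D h' : h' \in derived (full H) -> exists x, phi x = h'.
  apply: (gen_rec (P := [set h' | exists x, phi x = h'])) =>
    [|_ _ [u <-] [v <-]|_ [u <-]|_ [y [z [_ _ ->]]]] /=.
  - by exists 1; rewrite gmulf1.
  - by exists (u * v); rewrite gmulfM.
  - by exists u^-1; rewrite gmulfV.
  - have [u [m [mM ->]]] := dec y; have [v [n [nM ->]]] := dec z.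
    have /asboolP mZ := MZ _ mM; have /asboolP nZ := MZ _ nM.
    exists [~ u, v]; rewrite gmulfR.
    have cent (k w : H) : (forall y', commute k y') -> w ^ k = w.
      by move=> kZ; rewrite conjgE -(kZ w) mulKg.
    have c1 (k w : H) : (forall y', commute k y') -> [~ k, w] = 1.
      by move=> kZ; apply/eqP/commgP/kZ.
    rewrite commgMl commgMr (cent m)// (cent n)// (c1 m)// -[[~ phi u,
      n]]invgR (c1 n)//.
    by rewrite invg1 mulg1 mul1g.
have [x [m [mM ->]]] := dec h; have [y <-] := D _ (MD _ mM).
by exists (x * y); rewrite gmulfM.
Qed.

(** * The isomorphism of tauflat H with K(H, 3) *)

Section Psi.
Variables (R : realType) (G : finGroupType) (H : groupType).
Variables (M : groupClosed H) (HM : schur_cover R G M).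
Variables (alpha : ghom H H) (alphaV : H -> H).
Hypotheses (alphaK : cancel alpha alphaV) (alphaVK : cancel alphaV alpha).
Hypothesis alphaAI : AI_automorphism alpha.
Variables (r : nat) (p : ghom (free_group 'I_r) G).
Hypothesis p_surj : forall g, exists x, p x = g.
Local Notation F := (free_group 'I_r).
Local Notation T := (tauflat H).
Local Notation H' := (derived (full H)).
Local Notation ab := (qmap [set` H']).

Lemma ab_eq1 x : (ab x == 1) = (x \in H').
Proof. by rewrite qmap_ker normal_closure_id//; exact: derived_full_normal. Qed.

Lemma abV x : ab x^-1 = (ab x)^-1. Proof. exact: gmulfV. Qed.

Lemma AI_mul x : x * alpha x \in H'.
Proof. by rewrite -ab_eq1 qmapM alphaAI.2 mulgV. Qed.

Lemma AI_mulC x : alpha x * x \in H'.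
Proof. by rewrite -ab_eq1 qmapM alphaAI.2 mulVg. Qed.

(** The AI-automorphism appears in the middle coordinate only. *)
Lemma Psi_exists : exists Psi : ghom T {ffun 'I_3 -> H},
  (forall x, Psi (tfL x) = mk3 x (alpha x) 1) /\
  (forall x, Psi (tfR x) = mk3 1 (alpha x) x).
Proof.
pose f x := mk3 x (alpha x) 1; pose g x := mk3 1 (alpha x) x.
have fM : {morph f : x y / x * y} by move=> x y; rewrite mk3M mulg1 -gmulfM.
have gM : {morph g : x y / x * y} by move=> x y; rewrite mk3M mulg1 -gmulfM.
pose fH := isUMagmaMorphism.Build _ _ f (morph_hom fM).
pose gH := isUMagmaMorphism.Build _ _ g (morph_hom gM).
pose f' : ghom H {ffun 'I_3 -> H} := HB.pack f fH.
pose g' : ghom H {ffun 'I_3 -> H} := HB.pack g gH.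
have wE x y : wedge f' g' x y = mk3 1 (alpha [~ x, y]) 1.
  by rewrite /wedge /= mk3R commg1 comm1g -gmulfR.
apply: (@tf_lift H _ f' g') => [x y z|x y z|x y xy].
- by rewrite !wE /= mk3J !conj1g -gmulfJ conjRg.
- by rewrite !wE /= mk3J !conj1g -gmulfJ conjRg.
- by rewrite wE; have/commgP/eqP-> := xy; rewrite gmulf1 mk31.
Qed.

Variable Psi : ghom T {ffun 'I_3 -> H}.
Hypothesis PsiL : forall x, Psi (tfL x) = mk3 x (alpha x) 1.
Hypothesis PsiR : forall x, Psi (tfR x) = mk3 1 (alpha x) x.

Lemma Psi_wedge x y : Psi (tfw x y) = mk3 1 (alpha [~ x, y]) 1.
Proof. by rewrite [LHS]gmulfR PsiL PsiR mk3R commg1 comm1g -gmulfR. Qed.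

Lemma Psi_Kset t : Psi t \in Kset 3 (full H).
Proof.
elim/tf_ind: t => [|x t IH|x t IH].
- by rewrite gmulf1; exact: gpred1.
- rewrite gmulfM PsiL; apply: gpredM => //; apply: mk3_KsetP => //.
  by rewrite mulg1; exact: AI_mul.
- rewrite gmulfM PsiR; apply: gpredM => //; apply: mk3_KsetP => //.
  by rewrite mul1g; exact: AI_mulC.
Qed.

Lemma Psi_mid h : h \in H' -> exists t, Psi t = mk3 1 h 1.
Proof.
move=> hH'; have [h' h'H <-] := derived_lift (f := alpha) (fun y =>
  ex_intro _ _ (alphaVK y)) hH'.
move: h' h'H => h' {hH' h}.
apply: (gen_rec (P := [set h | exists t, Psi t = mk3 1 (alpha h) 1])) =>
  [|u v [t tE] [t' t'E]|u [t tE]|_ [y [z [_ _ ->]]]] /=.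
- by exists 1; rewrite !gmulf1 mk31.
- by exists (t * t'); rewrite !gmulfM tE t'E mk3M !mulg1.
- by exists t^-1; rewrite !gmulfV tE mk3V !invg1.
- by exists (tfw y z); exact: Psi_wedge.
Qed.

Lemma Psi_surj g : g \in Kset 3 (full H) -> exists t, Psi t = g.
Proof.
rewrite [g]mk3_eta; move: (g pos0) (g pos1) (g pos2) => a b c {g}.
case/mk3_Kset => _ _ _ abc.
have [t tE] : exists t, Psi t = mk3 1 ((alpha (a * c))^-1 * b) 1.
  apply: Psi_mid; rewrite -ab_eq1 qmapM abV alphaAI.2 invgK qmapM.
  by rewrite -mulgA (abelianization_comm (ab c)) -!qmapM ab_eq1.
(* The middle coordinate of tfL a * tfR c is alpha (a * c); t corrects it to
   b. *)
exists (tfL a * tfR c * t); rewrite !gmulfM PsiL PsiR tE !mk3M.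
by rewrite !mulg1 mul1g -[alpha a * _]gmulfM mulKVg.
Qed.

Section WithLift.
Variable phi : ghom F H.
Hypothesis phiM : forall x, (phi x \in M) = (p x == 1).
Hypothesis phi_surj : forall h, exists x, phi x = h.

Lemma M_comm m h : m \in M -> commute m h.
Proof. by move=> /(schur_cover_center HM)/asboolP. Qed.

Lemma phi_commNF x : x \in commNF p -> phi x = 1.
Proof.
apply: (gen_rec (P := [set x | phi x = 1])) => [|u v|u|_ [n [z [pn ->]]]] /=.
- by rewrite gmulf1.
- by rewrite gmulfM => -> ->; rewrite mulg1.
- by rewrite gmulfV => ->; rewrite invg1.
- by rewrite gmulfR; apply/eqP/commgP/M_comm; rewrite phiM pn.
Qed.

(** The Hopf formula for the Schur cover. *)
Lemma phi_commNF_inv x : x \in derived (full F) -> phi x = 1 -> x \in commNF p.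
Proof.
move=> xF phix; have px : p x = 1 by apply/eqP; rewrite -phiM phix gpred1.
apply: (schur_cover_lift_inj p_surj (schur_cover_multiplier HM) _ phi_commNF)
  => // m mM.
have [y yF yE] := derived_lift phi_surj (schur_cover_derived HM mM).
by exists y; split=> //; apply/eqP; rewrite -phiM yE.
Qed.

(** By [crossed_ext_free], a product of wedges that Psi kills is the image of
    an element of F' killed by phi, hence of an element of [N, F]. *)
Lemma Psi_inj : injective Psi.
Proof.
have [q cp] := tf_crossed_pair H.
have [P [j [s [j_inj sR]]]] := crossed_ext_free cp phi.
have wF w : w \in @tfW H -> exists x,
    [/\ x \in derived (full F), s x = j w & Psi w = mk3 1 (alpha (phi x)) 1].
  apply: (gen_rec (P := [set w | exists x, [/\ x \in derived (full F), s x = j w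
    & Psi w = mk3 1 (alpha (phi x)) 1]])) =>
    [|u v [x [xF sx ux]] [y [yF sy vy]]|u [x [xF sx ux]]|_ [y' [z' ->]]] /=.
  - by exists 1; rewrite !gmulf1 gpred1 mk31.
  - exists (x * y); rewrite gpredM// !gmulfM sx sy ux vy mk3M !mulg1.
    by split.
  - by exists x^-1; rewrite gpredV !gmulfV sx ux mk3V !invg1; split.
  - have [y <-] := phi_surj y'; have [z <-] := phi_surj z'.
    exists [~ y, z]; rewrite derived_comm Psi_wedge.
    by rewrite [s _]gmulfR sR [phi [~ _, _]]gmulfR.
have sN x : x \in commNF p -> s x = 1.
  apply: (gen_rec (P := [set x | s x = 1])) => [|u v|u|_ [n [z [pn ->]]]] /=.
  - by rewrite gmulf1.
  - by rewrite gmulfM => -> ->; rewrite mulg1.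
  - by rewrite gmulfV => ->; rewrite invg1.
  - rewrite gmulfR sR -/(tfw _ _) tfw_commute ?gmulf1//.
    by apply: M_comm; rewrite phiM pn.
apply: gmulf_inj => t; have [x [y [w [wW ->]]]] := tf_split t.
have [f [fF sf wf]] := wF w wW.
rewrite !gmulfM PsiL PsiR wf !mk3M -mk31 => /mk3_inj[].
rewrite !(mulg1, mul1g) => -> + y1; rewrite y1 !gmulf1 !mul1g => af.
have phif : phi f = 1 by apply: (can_inj alphaK); rewrite af gmulf1.
by apply: j_inj; rewrite -sf (sN _ (phi_commNF_inv fF phif)) gmulf1.
Qed.

(** The triples that phi maps to triples of elements of M with product 1. *)
Definition central_triple (g : {ffun 'I_3 -> F}) : Prop :=
  (forall i, phi (g i) \in M) /\ phi (g pos0) * (phi (g pos1) * phi (g pos2)) =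
    1.

Lemma in_ker x : (x \in ker p) = (p x == 1). Proof. by []. Qed.

(** Modulo the normal closure of K(N, 3), the first coordinate matters only
    up to [N, F]. *)
Lemma commNF_first x : x \in commNF p ->
  mk3 x 1 1 \in normal_closure [set` Kset 3 (ker p)].
Proof.
apply: (gen_rec (P := [set x | mk3 x 1 1 \in normal_closure [set` Kset 3 (ker
  p)]])) =>
  [|u v uK vK|u uK|_ [n [z [pn ->]]]] /=.
- by rewrite mk31; exact: gpred1.
- by have := gpredM _ _ uK vK; rewrite mk3M !mulg1.
- by rewrite -(gpredV (normal_closure [set` Kset 3 (ker p)])) mk3V invgK invg1.
have nK : mk3 n n^-1 1 \in normal_closure [set` Kset 3 (ker p)].
  apply: normal_closure_sub; apply: mk3_KsetP;
    rewrite ?in_ker ?gmulfV ?gmulf1 ?pn ?invg1//.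
  by rewrite mulg1 mulgV gpred1.
(* Conjugating the first coordinate of (n, n^-1, 1) by z changes it by [~ n,
   z]. *)
have -> : mk3 [~ n, z] 1 1 = (mk3 n n^-1 1)^-1 * mk3 n n^-1 1 ^ mk3 z 1 1.
  by rewrite mk3V mk3J mk3M !conjg1 !mulVg.
by rewrite gpredM ?gpredV//; exact: (@normal_closureJ _ _ _ (mk3 z 1 1) nK).
Qed.

(** Inside K(F, 3), the normal closure of K(N, 3) is the preimage of the
    triples of elements of M with product 1. *)
Lemma Kset_ker_lift g : g \in Kset 3 (full F) ->
  (g \in normal_closure [set` Kset 3 (ker p)]) <-> central_triple g.
Proof.
move=> gK; split.
  apply: normal_closure_rec => [|x y [xM x1] [yM y1]|x [xM x1]|x y [xM x1]|x
    xK].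
  - split=> [i|]; first by rewrite ffunE gmulf1 gpred1.
    by rewrite !ffunE !gmulf1 !mulg1.
  - split=> [i|]; first by rewrite ffunE gmulfM; apply: gpredM;
    [exact: xM|exact: yM].
    rewrite !ffunE !gmulfM (commute_mulACA (phi (x pos1)));
      last by apply: M_comm; exact: yM.
    rewrite [LHS]commute_mulACA ?x1 ?y1 ?mulg1//.
    by apply: M_comm; exact: yM.
  - split=> [i|]; first by rewrite ffunE gmulfV gpredV; exact: xM.
    rewrite !ffunE !gmulfV -!invgM -[RHS]invg1 -x1; congr (_^-1).
    rewrite (M_comm (phi (x pos1)) (xM pos2)) -(M_comm _ (xM pos0)).
    by congr (_ * _); apply: M_comm; exact: xM.
  - have phiJ i : phi ((x ^ y) i) = phi (x i).
      by rewrite !ffunE gmulfJ conjgE (M_comm _ (xM i)) mulKg.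
    by split=> [i|]; rewrite !phiJ; [exact: xM|exact: x1].
  case/andP: xK => /forallP xN x1; split=> [i|].
    by rewrite phiM; exact: xN.
  rewrite -!gmulfM -prod3.
  apply: (gen_rec (P := [set x | phi x = 1])) x1 =>
    [|u v|u|_ [u [v [uN vN ->]]]] /=.
  - by rewrite gmulf1.
  - by rewrite gmulfM => -> ->; rewrite mulg1.
  - by rewrite gmulfV => ->; rewrite invg1.
  - by rewrite gmulfR; apply/eqP/commgP/M_comm; rewrite phiM -in_ker.
move=> [gM g1].
have gi i : p (g i) = 1 by apply/eqP; rewrite -phiM; exact: gM.
have : g pos0 * (g pos1 * g pos2) \in commNF p.
  apply: phi_commNF_inv; last by rewrite !gmulfM.
  by case/andP: gK => _; rewrite prod3.
move=> /commNF_first dK.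
pose d := g pos0 * (g pos1 * g pos2).
(* The second factor lies in K(N, 3), since its coordinates have product 1. *)
have -> : g = mk3 d 1 1 * mk3 (d^-1 * g pos0) (g pos1) (g pos2).
  by rewrite mk3M mulKVg !mul1g -mk3_eta.
apply: gpredM => //; apply: normal_closure_sub; apply: mk3_KsetP.
- by rewrite in_ker gmulfM gmulfV !gmulfM !gi !mulg1 invg1.
- by rewrite in_ker gi.
- by rewrite in_ker gi.
- by rewrite -mulgA mulVg gpred1.
Qed.

Lemma phi3_Kset g : g \in Kset 3 (full F) ->
  [ffun i => phi (g i)] \in Kset 3 (full H).
Proof.
case/andP => _ gF; apply/andP; split; first exact/forallP.
rewrite prod3 !ffunE -!gmulfM; apply: derived_morph.
by move: gF; rewrite prod3.
Qed.

Lemma phi3_surj g : g \in Kset 3 (full H) ->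
  exists2 f, f \in Kset 3 (full F) & [ffun i => phi (f i)] = g.
Proof.
rewrite [g]mk3_eta; move: (g pos0) (g pos1) (g pos2) => a' b' c' {g}.
case/mk3_Kset => _ _ _; have [a <-] := phi_surj a'; have [b <-] := phi_surj b'.
have [c <-] := phi_surj c'; rewrite -!gmulfM => abcH.
have [d dF dE] := derived_lift phi_surj abcH.
(* The last coordinate is changed by an element of the kernel of phi that
   brings the product to d. *)
exists (mk3 a b (c * (a * (b * c))^-1 * d)).
  apply: mk3_KsetP => //.
  have E (e : F) : a * (b * (c / e * d)) = a * (b * c) / e * d by rewrite
    !mulgA.
  by rewrite E mulgV mul1g.
apply/ffunP => i; rewrite !ffunE; case: (val i) => [|[|_]]//.
by rewrite gmulfM gmulfM gmulfV dE mulgVK.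
Qed.

(** If I is the subgroup of tauflat H that Psi identifies with the triples of
    elements of M with product 1, then the composite of phi on K(F, 3) with
    the inverse of Psi induces an isomorphism onto tauflat H / I. *)
Lemma Ktilde_isomorphic (I : set T) :
  conj_stable I -> (forall x y, I x -> I y -> I (x * y)) ->
    (forall x, I x -> I x^-1) ->
  (forall t, I t <-> (forall i,
    Psi t i \in M) /\ Psi t pos0 * (Psi t pos1 * Psi t pos2) = 1) ->
  isomorphic (Ktilde p 3) (quot I).
Proof.
move=> IJ IM IV IP.
have [th thE] := choice (fun g : subgroup_type (Kset 3 (full F)) =>
  Psi_surj (phi3_Kset (valP g))).
(* th g is the preimage under Psi of the image of g by phi. *)
pose f0 g := qmap I (th g).
have f0M : {morph f0 : g h / g * h}.
  move=> g h; rewrite /f0 -qmapM; congr (qmap I _); apply: Psi_inj.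
  rewrite gmulfM !thE; apply/ffunP => i; rewrite !ffunE.
  by rewrite gmulfM.
pose fH := isUMagmaMorphism.Build _ _ f0 (morph_hom f0M).
pose f : ghom (subgroup_type (Kset 3 (full F))) (quot I) := HB.pack f0 fH.
apply: (quot_isomorphic (f := f)) => [y|g].
  case: (qmap_surj y) => t <-.
  have [g gK gE] := phi3_surj (Psi_Kset t).
  exists (exist _ g gK); congr (qmap I _); apply: Psi_inj.
  by rewrite thE gE.
have I1 : I 1.
  by apply/IP; rewrite gmulf1; split=> [i|]; rewrite !ffunE ?mulg1// gpred1.
rewrite /= Kset_ker_lift; last exact: valP.
have -> : central_triple (val g) <-> I (th g).
  rewrite IP thE /central_triple !ffunE; split=> -[gM g1]; split=> // i;
    have := gM i;
    by rewrite ffunE.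
split=> [Ig|/eqP]; first by apply/eqP; rewrite /f0 qmap_ker normal_closure_sub.
by rewrite /f0 qmap_ker; apply: (normal_closure_rec (P := I)).
Qed.

End WithLift.
End Psi.

Theorem proposition6p2 (R : realType) (G : finGroupType) (H : groupType)
    (M : groupClosed H) (HM : schur_cover R G M)
    (alpha : ghom H H) (alphaV : H -> H)
    (alphaK : cancel alpha alphaV) (alphaVK : cancel alphaV alpha)
    (alphaAI : AI_automorphism alpha)
    (r : nat) (p : ghom (free_group 'I_r) G)
    (p_surj : forall g, exists x, p x = g) :
  let commutator_expr (m1 m2 : subgroup_type M) (l : nat) (h k : 'I_l -> H) :=
    alpha (val m1 * val m2) =
      (val m2)^-1 * (val m1)^-1 *
        \prod_(i < l) [~ h (rev_ord i), k (rev_ord i)] in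
  (forall m1 m2 : subgroup_type M, exists (l : nat) (h k : 'I_l -> H),
     commutator_expr m1 m2 l h k) /\
  exists iota : ghom (subgroup_type M * subgroup_type M)%type (tauflat H),
    [/\ injective iota,
        forall (m1 m2 : subgroup_type M) (l : nat) (h k : 'I_l -> H),
          commutator_expr m1 m2 l h k ->
          iota (m1, m2) =
            tauflatL (val m1) * tauflatR (val m2) *
              \prod_(i < l)
                [~ tauflatL (alphaV (k i)), tauflatR (alphaV (h i))],
        conj_stable (range iota) &
        isomorphic (Ktilde p 3) (quot (range iota))].
Proof.
move=> commutator_expr; split=> [m1 m2|].
  have [l [h [k hkE]]] := derived_prod (AI_mul alphaAI (val m1 * val m2)).
  by exists l, h, k; rewrite /commutator_expr -hkE -invgM mulKg.
have [phi [phiM phi_surj]] := schur_cover_lift HM p_surj.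
have [Psi [PsiL PsiR]] := Psi_exists alpha.
have PsiI := Psi_inj HM alphaK p_surj PsiL PsiR phiM phi_surj.
have MC (m : subgroup_type M) h : commute (val m) h by exact: (M_comm HM _
  (valP m)).
have MCC (m n : subgroup_type M) : m * n = n * m by apply: val_inj; exact: MC.
have val3 (m n : subgroup_type M) : val m * (val (m * n)^-1 * val n) = 1.
  by rewrite -!valM (MCC (m * n)^-1) mulgA mulgV.
have iota_ex (m : subgroup_type M * subgroup_type M) :
    exists t, Psi t = mk3 (val m.1) (val (m.1 * m.2)^-1) (val m.2).
  apply: (Psi_surj alphaVK alphaAI PsiL PsiR).
  by apply: mk3_KsetP => //; rewrite val3 gpred1.
have [iota0 ioE] := choice iota_ex.
have ioM : {morph iota0 : m n / m * n}.
  move=> [m1 m2] [n1 n2]; apply: PsiI; rewrite gmulfM !ioE mk3M.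
  have E : (m1 * n1 * (m2 * n2))^-1 = (m1 * m2)^-1 * (n1 * n2)^-1.
    by rewrite (abel_mulACA MCC) invgM MCC.
  by congr mk3; exact: (congr1 val E).
pose ioH := isUMagmaMorphism.Build _ _ iota0 (morph_hom ioM).
pose iota : ghom (subgroup_type M * subgroup_type M)%type (tauflat H) :=
  HB.pack iota0 ioH.
have iotaE m : Psi (iota m) = mk3 (val m.1) (val (m.1 * m.2)^-1) (val m.2).
  exact: ioE.
have iotaJ : conj_stable (range iota).
  move=> _ t [m _ <-]; exists m => //; apply: PsiI.
  rewrite gmulfJ iotaE [Psi t]mk3_eta mk3J.
  by congr mk3; rewrite conjgE MC mulKg.
exists iota; split=> //.
- move=> [m1 m2] [n1 n2] /(congr1 Psi); rewrite !iotaE => /mk3_inj[/= ? _ ?].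
  by congr (_, _); apply: val_inj.
- move=> m1 m2 l h k hkE; apply: PsiI; rewrite iotaE !gmulfM.
  rewrite [Psi (tauflatL _)]PsiL [Psi (tauflatR _)]PsiR gmulf_prod.
  under eq_bigr do rewrite -/(tfw _ _) (Psi_wedge PsiL PsiR) gmulfR !alphaVK
    -invgR.
  have midM : {morph (fun u : H => mk3 1 u 1) : u v / u * v}.
    by move=> u v; rewrite mk3M !mulg1.
  (* The product of the inverses in increasing order cancels the product that
     hkE takes in decreasing order. *)
  rewrite -(big_morph _ midM (mk31 H)) prodV_rev_ord !mk3M !mulg1 mul1g.
  by congr mk3; rewrite -[alpha _ * _]gmulfM hkE mulgK -invgM.
apply: (Ktilde_isomorphic HM alphaK alphaVK alphaAI p_surj PsiL PsiR phiM
  phi_surj iotaJ).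
- by move=> _ _ [m _ <-] [n _ <-]; exists (m * n) => //; rewrite gmulfM.
- by move=> _ [m _ <-]; exists m^-1 => //; rewrite gmulfV.
move=> t; split=> [[m _ <-]|[tM t1]].
  rewrite iotaE; split=> [i|].
    by rewrite ffunE; case: (val i : nat) => [|[|_]]; exact: valP.
  by rewrite !mk3E val3.
pose m1 : subgroup_type M := exist (fun x => x \in M) _ (tM pos0).
pose m2 : subgroup_type M := exist (fun x => x \in M) _ (tM pos2).
exists (m1, m2) => //; apply: PsiI; rewrite iotaE [RHS]mk3_eta /=.
congr mk3; apply: (mulIg (val m2)); apply: (mulgI (val m1)).
exact: etrans (val3 m1 m2) (esym t1).
Qed.
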